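(* Let $n$ be a positive integer and let $A_n$ be the alternating group on $n$ letters. \begin{enumerate} \item If $n\leq 11$ or $n=15$, then $\delta(A_n)=\Delta(A_n)$. \item If $n=12$, $n=16$, $n=18$ or $n\geq 20$, then $\delta(A_n)\neq\Delta(A_n)$. \end{enumerate}
   Context: For a finite group $G$: a non-commuting subset of $G$ is a subset $N\subseteq G$ such that $xy\neq yx$ for all distinct $x,y\in N$; $\delta(G)$ is the maximum possible cardinality of a non-commuting subset of $G$. An abelian cover of $G$ is a set of abelian subgroups of $G$ whose union contains $G$; $\Delta(G)$ is the minimum possible cardinality of an abelian cover of $G$. *)

(* Defs.v *)
From mathcomp Require Import all_boot all_fingroup all_solvable.

Set Implicit Arguments.
Unset Strict Implicit.
Unset Printing Implicit Defensive.

Local Open Scope group_scope.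

Definition noncommuting_subset (gT : finGroupType) (G : {group gT})
    (N : {set gT}) : bool :=
  (N \subset G) &&
  [forall x in N, forall y in N, (x != y) ==> (x * y != y * x)].

Definition delta (gT : finGroupType) (G : {group gT}) : nat :=
  \max_(N : {set gT} | noncommuting_subset G N) #|N|.

Definition abelian_cover (gT : finGroupType) (G : {group gT})
    (C : {set {group gT}}) : bool :=
  [forall H in C, (H \subset G) && abelian H] &&
  (G \subset \bigcup_(H in C) H).

Definition cyclic_cover (gT : finGroupType) (G : {group gT})
    : {set {group gT}} :=
  [set <[x]>%G | x in G].

Lemma cyclic_cover_abelian (gT : finGroupType) (G : {group gT}) :
  abelian_cover G (cyclic_cover G).
Proof.
apply/andP; split.
  apply/forall_inP => _ /imsetP[x Gx ->].
  by rewrite cycle_subG Gx cycle_abelian.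
apply/subsetP => x Gx; apply/bigcupP; exists <[x]>%G; last exact: cycle_id.
exact: imset_f.
Qed.

(* [arg min] needs a witness satisfying its condition; by
   [cyclic_cover_abelian] the cyclic cover is one, so this is a true minimum
   (see [Delta_min] and [Delta_attained]). *)
Definition Delta (gT : finGroupType) (G : {group gT}) : nat :=
  #|[arg min_(C < cyclic_cover G | abelian_cover G C) #|C|]|.

Lemma Delta_min (gT : finGroupType) (G : {group gT}) (C : {set {group gT}}) :
  abelian_cover G C -> Delta G <= #|C|.
Proof.
move=> coverC; rewrite /Delta.
case: arg_minnP => [|D _ minD]; [exact: cyclic_cover_abelian | exact: minD].
Qed.

Lemma Delta_attained (gT : finGroupType) (G : {group gT}) :
  exists2 C : {set {group gT}}, abelian_cover G C & #|C| = Delta G.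
Proof.
exists [arg min_(C < cyclic_cover G | abelian_cover G C) #|C|] => //.
by case: arg_minnP => //; apply: cyclic_cover_abelian.
Qed.

(* Main.v *)
Require Import Defs.
From mathcomp Require Import all_boot all_fingroup all_solvable.

(** Call q : G -> G a selector when x commutes with q x, and q x and q y commute
    only if they are equal and x commutes with y.  The fibres of a selector
    generate an abelian cover and its values form a non-commuting set of the same
    size; conversely, when delta G = Delta G, a largest non-commuting set meets each
    member of a smallest cover exactly once, which defines a selector.  So
    delta G = Delta G amounts to the existence of a selector
    ([delta_eq_Delta_selector]).

    If y has an abelian centraliser, a selector cannot send x into that centraliser
    unless x commutes with y ([selector_abelian_cent]).  So only the elements that
    commute with no such y matter, and on them only the commuting graph.

    Inequality.  Write n = 8 + k and let f be an odd permutation of the last k points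
    with abelian centraliser, whose cycle lengths avoid 1, 2, 3, 4 and 6: a k-cycle
    for even k >= 8, an 8-cycle times a (k - 8)-cycle for odd k >= 13.  Consider the
    products a f with a in the class of S_8 of type (3, 2, 1, 1, 1).  A permutation
    commuting with a f splits as b h with b in S_8 commuting with a, and if b is not
    in that class again, there is h' in S_8 of type (6, 1, 1) or (4, 3, 1) commuting
    with b and not with a, such that h' f has an abelian centraliser.  Hence a
    selector of A_n would induce a self-map of the class with the same separation
    property.  On the class, up to inverting the 3-cycle, the commuting graph is made
    of Petersen graphs (transpositions of the 5 points off the 3-cycle) joined by
    a matching (exchange of the 3-cycle with the three points fixed by a); its
    cliques have at most 2 elements while its pentagons have no independent set with
    more than 2.  Averaging over the conjugates of one pentagon, an independent set
    has at most 2/5 of the vertices, whereas the image of the self-map has at least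
    1/2 of them ([class_no_selection]).  For n = 12 the filler f is a 4-cycle, and
    type (4, 3, 1) has to be replaced by a few cycle types of A_12.

    Equality.  For most cycle types in A_n with n <= 11 or n = 15, joining cycles of
    equal length into one yields a y with abelian centraliser such that x is a
    product of powers of its cycles; four types of A_15 need another y ([extra15]).
    No y is available in the types (4, 4) for n = 8, (4, 4, 1) for n = 9,
    (4, 4, 3) for n = 11, and (7, 4, 4), (6, 6, 3), (6, 4, 2, 2, 1),
    (6, 3, 3, 2, 1) for n = 15.  There the commuting graph falls into
    small connected pieces, and selectors of the pieces can be glued
    ([local_selectors]).  Each piece is the orbit of one explicit permutation under an
    explicit group, on which a selector is given by a short list of pairs of
    commuting permutations; a finite computation on words checks the data
    ([delta_eq_Delta_of_selector_check]). *)

Set Implicit Arguments.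
Unset Strict Implicit.
Unset Printing Implicit Defensive.

Local Open Scope group_scope.

(** * Selectors *)

(** The last clause says at once that the values form a non-commuting set and
    that every fibre is commutative (take q x = q y). *)
Definition selector (gT : finGroupType) (G : {set gT}) (q : gT -> gT) :=
  [/\ {in G, forall x, q x \in G}, {in G, forall x, commute x (q x)}
    & {in G &, forall x y, commute (q x) (q y) -> q x = q y /\ commute x y}].

Lemma noncommutingP (gT : finGroupType) (G : {group gT}) (N : {set gT}) :
  reflect (N \subset G /\ {in N &, forall x y, commute x y -> x = y})
          (noncommuting_subset G N).
Proof.
apply: (iffP andP) => -[sNG ncN]; split=> //.
  move=> x y Nx Ny cxy; apply/eqP; apply: contraT => neq_xy.
  move/forall_inP/(_ x Nx)/forall_inP/(_ y Ny): ncN.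
  by rewrite neq_xy /= cxy eqxx.
apply/forall_inP=> x Nx; apply/forall_inP=> y Ny; apply/implyP.
by apply: contra => /eqP/ncN->.
Qed.

Lemma delta_attained (gT : finGroupType) (G : {group gT}) :
  exists2 N : {set gT}, noncommuting_subset G N & #|N| = delta G.
Proof.
have nc0 : noncommuting_subset G set0.
  by apply/noncommutingP; split=> [|x y]; rewrite ?sub0set ?inE.
have exN : 0 < #|[pred N : {set gT} | noncommuting_subset G N]|.
  by apply/card_gt0P; exists set0.
have [N ncN cN] := eq_bigmax_cond (fun N : {set gT} => #|N|) exN.
by exists N; rewrite // /delta cN.
Qed.

Lemma abelian_cover_choice (gT : finGroupType) (G : {group gT}) C :
    abelian_cover G C ->
  exists F : gT -> {group gT}, {in G, forall x, F x \in C} /\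
    {in G &, forall x y, F x = F y -> commute x y}.
Proof.
case/andP=> /forall_inP abC /subsetP covC.
pose F x := odflt 1%G [pick H in C | x \in H].
have FP x : x \in G -> F x \in C /\ x \in F x.
  move=> Gx; rewrite /F; case: pickP => [H /andP[]//|noH].
  by have /bigcupP[H CH Hx] := covC x Gx; have := noH H; rewrite CH Hx.
exists F; split=> [x /FP[]//|x y /FP[CH Hx] /FP[_ Hy] eqF].
by have /andP[_ abH] := abC _ CH; apply: (centsP abH); rewrite // eqF.
Qed.

(** A non-commuting set meets each member of an abelian cover at most once. *)
Lemma delta_le_Delta (gT : finGroupType) (G : {group gT}) : delta G <= Delta G.
Proof.
have [N /noncommutingP[/subsetP sNG ncN] <-] := delta_attained G.
have [C /abelian_cover_choice[F [FC cF]] <-] := Delta_attained G.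
have injF : {in N &, injective F}.
  by move=> x y Nx Ny /cF-cxy; apply: ncN => //; apply: cxy; apply: sNG.
rewrite -(card_in_imset injF); apply/subset_leq_card/subsetP=> _ /imsetP[x Nx ->].
exact/FC/sNG.
Qed.

(** The members of the cover obtained from a selector are the subgroups generated by
    its fibres. *)
Lemma delta_eq_Delta_selector (gT : finGroupType) (G : {group gT}) :
  delta G = Delta G <-> exists q, selector G q.
Proof.
split=> [eq_dD | [q [Gq cq qP]]]; last first.
  apply/eqP; rewrite eqn_leq delta_le_Delta /=.
  pose N := q @: G; pose cl m := <<[set x in G | q x == m]>>%G.
  apply: leq_trans (_ : #|cl @: N| <= _).
    apply: Delta_min; apply/andP; split; last first.
      apply/subsetP=> x Gx; apply/bigcupP; exists (cl (q x)).
        by apply: imset_f; apply: imset_f.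
      by apply: mem_gen; rewrite inE Gx /=.
    apply/forall_inP=> _ /imsetP[_ /imsetP[x Gx ->] ->]; apply/andP; split.
      by rewrite gen_subG; apply/subsetP=> y; rewrite inE => /andP[].
    rewrite abelian_gen; apply/centsP=> y; rewrite inE => /andP[Gy /eqP qy] z.
    rewrite inE => /andP[Gz /eqP qz].
    by have [] := qP y z Gy Gz _; rewrite // qy qz.
  apply: leq_trans (leq_imset_card _ _) _.
  rewrite /delta (bigmax_sup N) //; apply/noncommutingP; split.
    by apply/subsetP=> _ /imsetP[x Gx ->]; apply: Gq.
  by move=> _ _ /imsetP[x Gx ->] /imsetP[y Gy ->] /(qP x y Gx Gy)[].
have [N /noncommutingP[/subsetP sNG ncN] cN] := delta_attained G.
have [C /abelian_cover_choice[F [FC cF]] cC] := Delta_attained G.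
have injF : {in N &, injective F}.
  by move=> x y Nx Ny /cF-cxy; apply: ncN => //; apply: cxy; apply: sNG.
(* Both cardinals agree, so every member of C is chosen by an element of N. *)
have FN : F @: N = C.
  apply/eqP; rewrite eqEcard card_in_imset // cN cC eq_dD leqnn andbT.
  by apply/subsetP=> _ /imsetP[x Nx ->]; apply/FC/sNG.
pose q x := odflt 1 [pick m in N | F m == F x].
have qP x : x \in G -> q x \in N /\ F (q x) = F x.
  move=> Gx; rewrite /q; case: pickP => [m /andP[Nm /eqP]//|noM].
  have := FC x Gx; rewrite -FN => /imsetP[m Nm eqF].
  by have := noM m; rewrite Nm eqF eqxx.
exists q; split=> [x /qP[/sNG]//|x Gx|x y Gx Gy cqq].
  by have [Nq Fq] := qP x Gx; apply: cF => //; apply: sNG.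
have [[Nqx Fqx] [Nqy Fqy]] := (qP x Gx, qP y Gy).
have eq_q := ncN _ _ Nqx Nqy cqq; split=> //.
by apply: cF; rewrite // -Fqx -Fqy eq_q.
Qed.

(** Both q x and q y lie in the abelian group 'C_G[y], so they commute, and then
    x and y commute. *)
Lemma selector_abelian_cent (gT : finGroupType) (G : {group gT}) q x y :
    selector G q -> x \in G -> y \in G -> abelian 'C_G[y] ->
  commute (q x) y -> commute x y.
Proof.
case=> Gq cq qP Gx Gy abC cqy.
have [|_ //] := qP x y Gx Gy.
by apply: (centsP abC); apply/setIP; split; rewrite ?Gq //; apply/cent1P;
   [|apply/commute_sym/cq].
Qed.

(** * Gluing selectors *)

Definition uncovered (gT : finGroupType) (G Y : {set gT}) :=
  [set x in G | [forall y in Y, x * y != y * x]].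

Lemma in_uncovered (gT : finGroupType) (G Y : {set gT}) x :
  (x \in uncovered G Y) = (x \in G) && [forall y in Y, x * y != y * x].
Proof. by rewrite in_set. Qed.

(** On V choose K and p for one root of each connected component of the
    commuting graph of V: the component stays inside K because K is closed, and
    two values of the glued map that commute lie in one component.  An element
    outside V is sent to a fixed representative y of one of the centralisers
    'C_G[y], y in Y, that contain it; two such centralisers whose representatives
    commute coincide, and no element of V commutes with a representative. *)
Lemma local_selectors (gT : finGroupType) (G : {group gT}) (Y : {set gT}) :
    let V := uncovered G Y in
    Y \subset G -> {in Y, forall y, abelian 'C_G[y]} ->
    (forall x, x \in V -> exists K : {set gT}, exists p : gT -> gT,
       [/\ x \in K, {in K & V, forall a z : gT, commute a z -> z \in K},
           {in K, forall a, p a \in V /\ commute a (p a)}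
         & {in K &, forall a b,
             commute (p a) (p b) -> p a = p b /\ commute a b}]) ->
  exists q, selector G q.
Proof.
move=> V /subsetP sYG abY loc.
pose e x y := [&& x \in V, y \in V & x * y == y * x].
have esym : symmetric e.
  by move=> x y; rewrite /e eq_sym andbCA.
have csym : connect_sym e by apply: sym_connect_sym.
pose good x (Kp : {set gT} * {ffun gT -> gT}) :=
  [&& x \in Kp.1, [forall a in Kp.1, [forall z in V, (a * z == z * a) ==> (z \in Kp.1)]],
      [forall a in Kp.1, (Kp.2 a \in V) && (a * Kp.2 a == Kp.2 a * a)] &
      [forall a in Kp.1, forall b in Kp.1, (Kp.2 a * Kp.2 b == Kp.2 b * Kp.2 a) ==>
        ((Kp.2 a == Kp.2 b) && (a * b == b * a))]].
pose Kp x := odflt (set0, [ffun=> 1]) [pick Kp | good x Kp].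
have KpP x : x \in V -> good x (Kp x).
  move=> Vx; rewrite /Kp; case: pickP => // noKp.
  have [K [p [Kx clK pK qK]]] := loc x Vx.
  have /negP[] := negbT (noKp (K, finfun p)); apply/and4P; split=> //=.
  - by apply/forall_inP=> a Ka; apply/forall_inP=> z Vz; apply/implyP=> /eqP/clK->.
  - by apply/forall_inP=> a Ka; rewrite !ffunE; have [-> ->] := pK a Ka; rewrite eqxx.
  - apply/forall_inP=> a Ka; apply/forall_inP=> b Kb; rewrite !ffunE.
    by apply/implyP=> /eqP/(qK a b Ka Kb)[-> ->]; rewrite !eqxx.
pose K x := (Kp (root e x)).1; pose p x := (Kp (root e x)).2.
pose rep (B : {set gT}) := odflt 1 [pick y in Y | 'C_G[y] == B].
pose q x := if x \in V then p x x else
  rep 'C_G[odflt 1 [pick y in Y | x * y == y * x]].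
have rootV x : x \in V -> root e x \in V.
  move=> Vx; have := connect_root e x; case/connectP=> s.
  move: (root e x) => r; elim: s x Vx => [|z s IHs] x Vx /=; first by move=> _ ->.
  by case/andP=> /and3P[_ Vz _]; apply: IHs.
have connK x z : x \in V -> connect e (root e x) z -> z \in K x.
  move=> Vx; have /and4P[] := KpP _ (rootV x Vx).
  rewrite -/(K x) => Kr /forall_inP clK _ _ /connectP[s].
  elim: s (root e x) Kr => [|b s IHs] a Ka /=; first by move=> _ ->.
  case/andP=> /and3P[_ Vb cab] ps def_z; apply: (IHs b) => //.
  by move/forall_inP: (clK a Ka) => /(_ b Vb)/implyP; apply.
have inK x : x \in V -> x \in K x.
  by move=> Vx; apply: connK => //; rewrite csym connect_root.
have qV x : x \in V -> [/\ q x \in V, commute x (q x) & root e (q x) = root e x].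
  move=> Vx; have /and4P[_ _ /forall_inP pK _] := KpP _ (rootV x Vx).
  have /andP[Vp /eqP cp] := pK x (inK x Vx); rewrite /q Vx; split=> //.
  apply/eqP; rewrite (root_connect csym) csym; apply: connect1.
  by apply/and3P; split=> //; apply/eqP.
have qY x : x \in G -> x \notin V ->
    [/\ q x \in Y, x \in 'C_G[q x] & q x = rep 'C_G[q x]].
  move=> Gx; rewrite /q => nVx; rewrite (negPf nVx).
  have [y Yy cxy] : exists2 y, y \in Y & x * y == y * x.
    move: nVx; rewrite inE Gx negb_forall_in => /exists_inP[y Yy /negPn].
    by exists y.
  case: pickP => [y' /andP[Yy' cxy'] /=|/(_ y)]; last by rewrite Yy cxy.
  have repP z : z \in Y -> rep 'C_G[z] \in Y /\ 'C_G[rep 'C_G[z]] = 'C_G[z].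
    move=> Yz; rewrite /rep; case: pickP => [t /andP[Yt /eqP]//|/(_ z)].
    by rewrite Yz eqxx.
  have [Yr Cr] := repP y' Yy'; split=> //; last by rewrite Cr.
  by rewrite Cr inE Gx /=; apply/cent1P; apply/eqP.
exists q; split=> [x Gx|x Gx|x y Gx Gy].
- have [/qV[]|/(qY x Gx)[/sYG]//] := boolP (x \in V).
  by rewrite inE => /andP[].
- have [/qV[]//|/(qY x Gx)[_]] := boolP (x \in V).
  by rewrite inE => /andP[_ /cent1P/commute_sym].
have VY a b : a \in V -> b \in Y -> ~ commute a b.
  by rewrite inE => /andP[_ /forall_inP Va] /Va/eqP.
have [Vx|nVx] := boolP (x \in V); have [Vy|nVy] := boolP (y \in V).
- have [Vqx cqx rqx] := qV x Vx; have [Vqy cqy rqy] := qV y Vy => cqq.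
  have rxy : root e x = root e y.
    rewrite -rqx -rqy; apply/eqP; rewrite (root_connect csym); apply: connect1.
    by apply/and3P; split=> //; apply/eqP.
  have /and4P[_ _ _ /forall_inP pK] := KpP _ (rootV x Vx).
  have Kyx : y \in K x by rewrite /K rxy inK.
  have:= pK x (inK x Vx) => /forall_inP/(_ y Kyx)/implyP.
  move: cqq; rewrite /q Vx Vy /p -rxy => cqq /(_ (introT eqP cqq)).
  by case/andP=> /eqP -> /eqP.
- by have [Vqx _ _] := qV x Vx; have [Yqy _ _] := qY y Gy nVy => /VY[].
- have [Vqy _ _] := qV y Vy; have [Yqx _ _] := qY x Gx nVx.
  by move/commute_sym/VY => [].
have [Yqx Cx rx] := qY x Gx nVx; have [Yqy Cy ry] := qY y Gy nVy => cqq.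
have sub a b : a \in Y -> b \in Y -> commute a b -> 'C_G[a] \subset 'C_G[b].
  move=> Ya Yb cab; apply/subsetP=> z Cz.
  have Cb : b \in 'C_G[a] by apply/setIP; split; [apply: sYG | apply/cent1P/commute_sym].
  have czb := centsP (abY a Ya) z Cz b Cb; case/setIP: Cz => Gz _.
  by apply/setIP; split; last apply/cent1P.
have eqC : 'C_G[q x] = 'C_G[q y].
  by apply/eqP; rewrite eqEsubset !sub //; apply: commute_sym.
split; first by rewrite rx eqC -ry.
by apply: (centsP (abY _ Yqx)); rewrite // eqC.
Qed.

(** * Centralisers of permutations with two disjoint supports *)

Lemma porbitJ (T : finType) (s t : {perm T}) x :
  porbit (s ^ t) (t x) = t @: porbit s x.
Proof.
apply/setP=> y; apply/porbitP/imsetP=> [[i ->]|[_ /porbitP[i ->] ->]].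
  by exists ((s ^+ i) x); rewrite ?mem_porbit // -conjXg permJ.
by exists i; rewrite -conjXg permJ.
Qed.

Lemma card_porbitJ (T : finType) (s t : {perm T}) x :
  #|porbit (s ^ t) (t x)| = #|porbit s x|.
Proof. by rewrite porbitJ card_imset //; apply: perm_inj. Qed.

Lemma card_porbit_commute (T : finType) (s t : {perm T}) x :
  commute s t -> #|porbit s (t x)| = #|porbit s x|.
Proof.
move=> cst; have st : s ^ t = s by apply/conjg_fixP/commgP.
by rewrite -{1}st card_porbitJ.
Qed.

(** Two permutations that act on each cycle of s as powers of s commute. *)
Lemma commute_porbit_abelian (T : finType) (s : {perm T}) :
  (forall t x, commute s t -> t x \in porbit s x) -> abelian 'C[s].
Proof.
move=> sub; apply/centsP=> t /cent1P cst u /cent1P csu.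
apply/permP=> x; rewrite !permM.
have /porbitP[i ti] := sub t x (commute_sym cst).
have /porbitP[j uj] := sub u x (commute_sym csu).
have ct n y : t ((s ^+ n) y) = (s ^+ n) (t y).
  by rewrite -!permM (commuteX n cst).
have cu n y : u ((s ^+ n) y) = (s ^+ n) (u y).
  by rewrite -!permM (commuteX n csu).
by rewrite ti uj ct cu ti uj -!permM -!expgD addnC.
Qed.

Section JoinPerm.
Variables m k : nat.
Implicit Types (a b : {perm 'I_m}) (f g : {perm 'I_k}).

(** The permutation of m + k points acting as a on the first m and as f on the
    last k; the natural setting for centralisers of products with a filler. *)
Definition join_fun a f (i : 'I_(m + k)) : 'I_(m + k) :=
  match split i with inl u => lshift k (a u) | inr v => rshift m (f v) end.

Lemma join_fun_inj a f : injective (join_fun a f).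
Proof.
apply: (can_inj (g := join_fun a^-1 f^-1)) => i; rewrite /join_fun.
case: (split_ordP i) => j ->.
  by rewrite (unsplitK (inl _)) permK.
by rewrite (unsplitK (inr _)) permK.
Qed.

Definition join_perm a f : {perm 'I_(m + k)} := perm (@join_fun_inj a f).

Lemma join_perm_lshift a f u : join_perm a f (lshift k u) = lshift k (a u).
Proof. by rewrite permE /join_fun (unsplitK (inl _)). Qed.

Lemma join_perm_rshift a f v : join_perm a f (rshift m v) = rshift m (f v).
Proof. by rewrite permE /join_fun (unsplitK (inr _)). Qed.

Lemma join_permM a b f g :
  join_perm a f * join_perm b g = join_perm (a * b) (f * g).
Proof.
apply/permP=> i; case: (split_ordP i) => j ->; rewrite permM.
  by rewrite !join_perm_lshift permM.
by rewrite !join_perm_rshift permM.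
Qed.

Lemma join_perm_inj a b f g :
  join_perm a f = join_perm b g -> a = b /\ f = g.
Proof.
move=> eq_j; split; apply/permP=> i.
  by apply: (@lshift_inj m k); rewrite -!(join_perm_lshift _ f) eq_j
    !join_perm_lshift.
by apply: (@rshift_inj m k); rewrite -!(join_perm_rshift a) eq_j !join_perm_rshift.
Qed.

Lemma commute_join_perm a b f g :
  commute (join_perm a f) (join_perm b g) <-> commute a b /\ commute f g.
Proof.
rewrite /commute !join_permM; split=> [/join_perm_inj //|[-> ->] //].
Qed.

(** Decompose both factors into transpositions. *)
Lemma odd_join_perm a f : odd_perm (join_perm a f) = odd_perm a (+) odd_perm f.
Proof.
have -> : join_perm a f = join_perm a 1 * join_perm 1 f.
  by rewrite join_permM mulg1 mul1g.
have j1 : join_perm 1 1 = 1.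
  apply/permP=> i; case: (split_ordP i) => j ->; rewrite perm1.
    by rewrite join_perm_lshift perm1.
  by rewrite join_perm_rshift perm1.
have jl a1 a2 : join_perm (a1 * a2) 1 = join_perm a1 1 * join_perm a2 1.
  by rewrite join_permM mulg1.
have jr f1 f2 : join_perm 1 (f1 * f2) = join_perm 1 f1 * join_perm 1 f2.
  by rewrite join_permM mulg1.
rewrite odd_permM; congr (_ (+) _).
  have [ts -> dts] := prod_tpermP a.
  elim: ts dts => [_|t ts IHts] /=; first by rewrite big_nil j1 !odd_perm1.
  case/andP=> _ /IHts; rewrite big_cons jl !odd_permM => ->.
  congr (_ (+) _); suff -> : join_perm (tperm t.1 t.2) 1 = tperm (lshift k t.1) (lshift k t.2).
    by rewrite !odd_tperm (inj_eq (@lshift_inj _ _)).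
  apply/permP=> i; case: (split_ordP i) => j ->.
    by rewrite join_perm_lshift (inj_tperm _ _ _ (@lshift_inj _ _)).
  by rewrite join_perm_rshift perm1 tpermD // eq_lrshift.
have [ts -> dts] := prod_tpermP f.
elim: ts dts => [_|t ts IHts] /=; first by rewrite big_nil j1 !odd_perm1.
case/andP=> _ /IHts; rewrite big_cons jr !odd_permM => ->.
congr (_ (+) _); suff -> : join_perm 1 (tperm t.1 t.2) = tperm (rshift m t.1) (rshift m t.2).
  by rewrite !odd_tperm (inj_eq (@rshift_inj _ _)).
apply/permP=> i; case: (split_ordP i) => j ->.
  by rewrite join_perm_lshift perm1 tpermD // eq_rlshift.
by rewrite join_perm_rshift (inj_tperm _ _ _ (@rshift_inj _ _)).
Qed.

Lemma join_permX a f n : join_perm a f ^+ n = join_perm (a ^+ n) (f ^+ n).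
Proof.
elim: n => [|n IHn]; last by rewrite !expgS IHn join_permM.
apply/permP=> i; case: (split_ordP i) => j ->; rewrite !expg0 perm1.
  by rewrite join_perm_lshift perm1.
by rewrite join_perm_rshift perm1.
Qed.

Lemma card_porbit_lshift a f u :
  #|porbit (join_perm a f) (lshift k u)| = #|porbit a u|.
Proof.
rewrite -(card_imset _ (@lshift_inj m k)); apply: eq_card => i.
apply/porbitP/imsetP=> [[n ->]|[_ /porbitP[n ->] ->]].
  by exists ((a ^+ n) u); rewrite ?mem_porbit // join_permX join_perm_lshift.
by exists n; rewrite join_permX join_perm_lshift.
Qed.

Lemma card_porbit_rshift a f v :
  #|porbit (join_perm a f) (rshift m v)| = #|porbit f v|.
Proof.
rewrite -(card_imset _ (@rshift_inj m k)); apply: eq_card => i.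
apply/porbitP/imsetP=> [[n ->]|[_ /porbitP[n ->] ->]].
  by exists ((f ^+ n) v); rewrite ?mem_porbit // join_permX join_perm_rshift.
by exists n; rewrite join_permX join_perm_rshift.
Qed.

(** A permutation commuting with s preserves the lengths of the cycles of s, so it
    cannot mix the two sets of points when no length occurs on both sides. *)
Lemma commute_join_permP a f z :
    (forall u v, #|porbit a u| != #|porbit f v|) ->
    commute z (join_perm a f) ->
  exists b g, [/\ z = join_perm b g, commute b a & commute g f].
Proof.
move=> neq_sz cz.
have zl u : exists u', z (lshift k u) = lshift k u'.
  have := card_porbit_commute (lshift k u) (commute_sym cz).
  case: (split_ordP (z (lshift k u))) => [u'|v] ->; first by exists u'.
  rewrite card_porbit_lshift card_porbit_rshift => /eqP.
  by rewrite eq_sym (negPf (neq_sz _ _)).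
have zr v : exists v', z (rshift m v) = rshift m v'.
  have := card_porbit_commute (rshift m v) (commute_sym cz).
  case: (split_ordP (z (rshift m v))) => [u|v'] ->; last by exists v'.
  rewrite card_porbit_lshift card_porbit_rshift => /eqP.
  by rewrite (negPf (neq_sz _ _)).
pose bf u := if split (z (lshift k u)) is inl u' then u' else u.
pose gf v := if split (z (rshift m v)) is inr v' then v' else v.
have bfE u : z (lshift k u) = lshift k (bf u).
  by rewrite /bf; have [u' ->] := zl u; rewrite (unsplitK (inl _)).
have gfE v : z (rshift m v) = rshift m (gf v).
  by rewrite /gf; have [v' ->] := zr v; rewrite (unsplitK (inr _)).
have bf_inj : injective bf.
  by move=> u u' eq_b; apply: (@lshift_inj m k); apply: (@perm_inj _ z); rewrite !bfE eq_b.
have gf_inj : injective gf.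
  by move=> v v' eq_g; apply: (@rshift_inj m k); apply: (@perm_inj _ z); rewrite !gfE eq_g.
have defz : z = join_perm (perm bf_inj) (perm gf_inj).
  apply/permP=> i; case: (split_ordP i) => j ->.
    by rewrite join_perm_lshift permE bfE.
  by rewrite join_perm_rshift permE gfE.
exists (perm bf_inj), (perm gf_inj).
by move: cz; rewrite {1}defz => /commute_join_perm[].
Qed.

Lemma abelian_cent_join_perm a f :
    (forall u v, #|porbit a u| != #|porbit f v|) ->
    abelian 'C[a] -> abelian 'C[f] ->
  abelian 'C[join_perm a f].
Proof.
move=> neq_sz aba abf; apply/centsP=> y /cent1P cy z /cent1P cz.
have [b [g [-> ba gf]]] := commute_join_permP neq_sz cy.
have [b' [g' [-> ba' gf']]] := commute_join_permP neq_sz cz.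
by apply/commute_join_perm; split; [apply: (centsP aba) | apply: (centsP abf)]; apply/cent1P.
Qed.

End JoinPerm.

Definition rot_perm n : {perm 'I_n} := perm (@ordS_inj n).

Lemma porbit_rot_perm n (i : 'I_n) : porbit (rot_perm n) i = [set: 'I_n].
Proof.
have rotX e (j : 'I_n) : (rot_perm n ^+ e) j = (j + e) %% n :> nat.
  elim: e => [|e IHe]; first by rewrite expg0 perm1 addn0 modn_small.
  by rewrite expgSr permM permE /= IHe -addn1 modnDml addn1 addnS.
apply/setP=> j; rewrite inE; apply/porbitP; exists (j + (n - i)).
apply: val_inj; rewrite /= rotX addnCA subnKC; last exact: ltnW.
by rewrite modnDr modn_small.
Qed.

Lemma card_porbit_rot_perm n (i : 'I_n) : #|porbit (rot_perm n) i| = n.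
Proof. by rewrite porbit_rot_perm cardsT card_ord. Qed.

Lemma abelian_cent_rot_perm n : abelian 'C[rot_perm n].
Proof. by apply: commute_porbit_abelian => t i _; rewrite porbit_rot_perm inE. Qed.

Lemma odd_rot_perm n : odd_perm (rot_perm n.+1) = odd n.
Proof.
rewrite /odd_perm card_ord.
suff -> : porbits (rot_perm n.+1) = [set [set: 'I_n.+1]] by rewrite cards1 /= addbT negbK.
apply/setP=> A; rewrite inE; apply/imsetP/eqP=> [[i _ ->]|->].
  by rewrite porbit_rot_perm.
by exists ord0; rewrite ?porbit_rot_perm.
Qed.

(** * Permutations as words *)

(** Words make equality and commutation of concrete permutations computable. *)
Definition word n (s : {perm 'I_n}) : seq nat := [seq val (s i) | i <- enum 'I_n].

Lemma size_word n (s : {perm 'I_n}) : size (word s) = n.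
Proof. by rewrite size_map size_enum_ord. Qed.

Lemma nth_word n (s : {perm 'I_n}) x0 (i : 'I_n) : nth x0 (word s) i = s i.
Proof. by rewrite (nth_map i) ?size_enum_ord // nth_ord_enum. Qed.

Lemma word_inj n : injective (@word n).
Proof.
by move=> s t eq_w; apply/permP=> i; apply: val_inj; rewrite /= -(nth_word s 0) eq_w nth_word.
Qed.

Lemma eq_word n (s : {perm 'I_n}) w :
  size w = n -> (forall i : 'I_n, nth 0 w i = s i) -> word s = w.
Proof.
move=> sz_w eq_w; apply: (@eq_from_nth _ 0); rewrite ?size_word // => i lt_in.
by rewrite -[i]/(val (Ordinal lt_in)) nth_word -eq_w.
Qed.

Definition is_word n w := [&& size w == n, uniq w & all (fun i => i < n) w].

Lemma is_word_word n (s : {perm 'I_n}) : is_word n (word s).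
Proof.
apply/and3P; split; first by rewrite size_word.
  by rewrite map_inj_uniq ?enum_uniq // => i j /val_inj/perm_inj.
by apply/allP=> _ /mapP[i _ ->] /=; apply: ltn_ord.
Qed.

Lemma is_wordP n w : is_word n w -> exists s : {perm 'I_n}, word s = w.
Proof.
case/and3P=> /eqP sz_w uniq_w /allP lt_w.
have lt_wi (i : 'I_n) : nth 0 w i < n by apply: lt_w; rewrite mem_nth ?sz_w.
have inj_w : injective (fun i => Ordinal (lt_wi i)).
  move=> i j /(congr1 val)/= /eqP.
  by rewrite nth_uniq ?sz_w // => /eqP/val_inj.
by exists (perm inj_w); apply: eq_word => // i; rewrite permE.
Qed.

Definition wmul u v := [seq nth 0 v i | i <- u].
Definition wcommute u v := wmul u v == wmul v u.
Definition wconj u v := [seq nth 0 v (nth 0 u (index i v)) | i <- iota 0 (size v)].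

Lemma word_mul n (s t : {perm 'I_n}) : word (s * t) = wmul (word s) (word t).
Proof. by rewrite /wmul -map_comp; apply: eq_map => i /=; rewrite nth_word permM. Qed.

Lemma wcommuteP n (s t : {perm 'I_n}) :
  reflect (commute s t) (wcommute (word s) (word t)).
Proof. by rewrite /wcommute -!word_mul (inj_eq (@word_inj n)); apply: eqP. Qed.

Lemma word_conj n (s t : {perm 'I_n}) : word (s ^ t) = wconj (word s) (word t).
Proof.
apply: eq_word => [|i]; first by rewrite size_map size_iota size_word.
rewrite (nth_map 0) ?size_iota ?size_word // nth_iota ?size_word // add0n.
have -> : index (i : nat) (word t) = (t^-1)%g i.
  rewrite -{1}[i](permKV t) -(nth_word t 0) index_uniq ?size_word //.
  by have /and3P[] := is_word_word t.
by rewrite nth_word nth_word conjgE !permM.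
Qed.

(** Removing the first letter of a word s multiplies the signature by the parity
    of that letter: this is [odd_lift_perm] with source index 0. *)
Fixpoint wodd n w :=
  if n is n'.+1 then odd (head 0 w) (+) wodd n' (map (unbump (head 0 w)) (behead w))
  else false.

Lemma odd_word n (s : {perm 'I_n}) : wodd n (word s) = odd_perm s.
Proof.
elim: n s => [|n IHn] s.
  by rewrite (_ : s = 1) ?odd_perm1 //; apply/permP=> -[].
pose f j := odflt j (unlift (s ord0) (s (lift ord0 j))).
have fP j : s (lift ord0 j) = lift (s ord0) (f j).
  have : s ord0 != s (lift ord0 j) by rewrite (inj_eq perm_inj) neq_lift.
  by rewrite /f => /unlift_some[j' -> ->].
have f_inj : injective f.
  by move=> i j eq_f; apply: (@lift_inj _ ord0); apply: (@perm_inj _ s); rewrite !fP eq_f.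
have def_s : s = lift_perm ord0 (s ord0) (perm f_inj).
  apply/permP=> i; case: (unliftP ord0 i) => [j ->|->].
    by rewrite lift_perm_lift permE fP.
  by rewrite lift_perm_id.
rewrite [in RHS]def_s odd_lift_perm /= -IHn.
have hd : head 0 (word s) = s ord0 by rewrite -nth0 -[0]/(val (ord0 : 'I_n.+1)) nth_word.
rewrite hd; congr (_ (+) wodd _ _).
apply/esym; apply: eq_word => [|j]; first by rewrite size_map size_behead size_word.
rewrite (nth_map 0) ?size_behead ?size_word //= nth_behead.
rewrite -[j.+1]/(val (lift ord0 j)) nth_word fP /= permE.
by rewrite bumpK.
Qed.

(** The length of the cycle through i: the first return time. *)
Definition wlen w i := (index i (traject (nth 0 w) (nth 0 w i) (size w))).+1.

Lemma iter_word n (s : {perm 'I_n}) e (i : 'I_n) :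
  iter e (nth 0 (word s)) i = iter e s i :> nat.
Proof. by elim: e => //= e ->; rewrite nth_word. Qed.

Lemma wlen_word n (s : {perm 'I_n}) (i : 'I_n) : wlen (word s) i = #|porbit s i|.
Proof.
have /prednK def_d : 0 < #|porbit s i| by rewrite lt0n card_porbit_neq0.
set d := #|porbit s i| in def_d *.
have lt_dn : d.-1 < n by rewrite def_d -[n in _ <= n]card_ord max_card.
rewrite /wlen size_word nth_word -def_d; congr _.+1.
have trj e : e < n -> nth (s i : nat) (traject (nth 0 (word s)) (s i) n) e = iter e.+1 s i.
  by move=> lt_en; rewrite nth_traject // iter_word iterSr.
have notin e : e < d.-1 -> iter e.+1 s i != i.
  move=> lt_e; have := uniq_traject_porbit s i; rewrite -/d -def_d /= => /andP[+ _].
  apply: contraNneq => eq_i; rewrite -[X in X \in _]eq_i.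
  by apply/trajectP; exists e; rewrite // -iterS iterSr.
(* The orbit returns to i at time d and at no earlier positive time. *)
have idx_le : index (i : nat) (traject (nth 0 (word s)) (s i) n) <= d.-1.
  rewrite leqNgt; apply/negP=> /(before_find (s i : nat))/=.
  by rewrite trj // def_d iter_porbit eqxx.
apply/eqP; rewrite eqn_leq idx_le /= leqNgt; apply/negP=> lt_idx.
have lt_n : index (i : nat) (traject (nth 0 (word s)) (s i) n) < n.
  exact: leq_ltn_trans idx_le lt_dn.
have := nth_index (s i : nat) (_ : (i : nat) \in traject (nth 0 (word s)) (s i) n).
rewrite -index_mem size_traject trj // => /(_ lt_n) /val_inj eq_i.
by have := notin _ lt_idx; rewrite eq_i eqxx.
Qed.

(** Entry k - 1 counts the points, not the cycles, on cycles of length k: a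
    conjugacy invariant that is cheap to compute and, by [ctype_class], complete. *)
Definition ctype w :=
  [seq count_mem k [seq wlen w i | i <- iota 0 (size w)] | k <- iota 1 (size w)].

Lemma ctypeE n (s : {perm 'I_n}) :
  ctype (word s) = [seq #|[set i | #|porbit s i| == k]| | k <- iota 1 n].
Proof.
rewrite /ctype size_word; apply: eq_map => k.
rewrite -val_enum_ord -map_comp count_map -sum1_count -sum1_card big_enum_cond.
by apply: eq_bigl => i; rewrite !inE /= wlen_word.
Qed.

Lemma ctype_conj n (s t : {perm 'I_n}) : ctype (word (s ^ t)) = ctype (word s).
Proof.
rewrite !ctypeE; apply: eq_map => k.
rewrite -[RHS](card_imset _ (@perm_inj _ t)); apply: eq_card => i.
apply/idP/imsetP=> [|[j]]; last first.
  by rewrite !inE => /eqP <- ->; rewrite card_porbitJ.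
rewrite inE => /eqP sz; exists (t^-1 i); last by rewrite permKV.
by rewrite inE -sz -{2}[i](permKV t) card_porbitJ.
Qed.

(** The default of [nth] closes the cycle, and points outside cs are fixed. *)
Definition cycle_image cs i :=
  foldr (fun c j => if i \in c then nth (head 0 c) c (index i c).+1 else j) i cs.

Definition wcycles n cs := [seq cycle_image cs i | i <- iota 0 n].

(** cs lists all cycles, including the fixed points, of the permutation it
    defines. *)
Definition cycles_ok n cs :=
  let w := wcycles n cs in
  [&& is_word n w, perm_eq (flatten cs) (iota 0 n) &
   all (fun c => (c == traject (nth 0 w) (head 0 c) (size c)) &&
                 (wlen w (head 0 c) == size c)) cs].

Definition products := foldr (fun (l acc : seq (seq nat)) =>
  [seq x ++ y | x <- l, y <- acc]) [:: [::]].

(** A permutation commuting with w is determined by the images of the heads of the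
    cycles, which lie on cycles of the same length; im lists the images of
    flatten cs in that order.  The list may contain other words; that
    it contains the whole centraliser is what the checks rely on. *)
Definition centralizer_words n cs :=
  let w := wcycles n cs in
  let images c := [seq traject (nth 0 w) i (size c) | i <- iota 0 n & wlen w i == size c] in
  let addr := [seq index i (flatten cs) | i <- iota 0 n] in
  [seq z <- [seq [seq nth 0 im a | a <- addr] | im <- products (map images cs)] | uniq z].

Lemma centralizer_words_complete n cs (s t : {perm 'I_n}) :
  cycles_ok n cs -> word s = wcycles n cs -> commute s t ->
  word t \in centralizer_words n cs.
Proof.
case/and3P=> _ perm_cs /allP cyc_cs def_w cst.
rewrite /centralizer_words -def_w mem_filter; have /and3P[_ -> _] := is_word_word t.
set images := fun c : seq nat => _.
rewrite /=; apply/mapP.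
have csz (i : nat) : i < n -> nth 0 (word t) i < n /\
    wlen (word s) (nth 0 (word t) i) = wlen (word s) i.
  move=> lt_in; rewrite -[i]/(val (Ordinal lt_in)) nth_word; split=> //.
  by rewrite !wlen_word card_porbit_commute.
have tX (i : 'I_n) e :
    nth 0 (word t) (iter e (nth 0 (word s)) i) = iter e (nth 0 (word s)) (nth 0 (word t) i).
  rewrite nth_word !iter_word nth_word -!permX -!permM.
  by rewrite (commuteX e (commute_sym cst)).
have lt_cs c : c \in cs -> 0 < size c -> head 0 c < n.
  move=> cs_c sz_c; have : head 0 c \in flatten cs.
    by apply/flattenP; exists c; rewrite // -nth0 mem_nth.
  by rewrite (perm_mem perm_cs) mem_iota.
exists (map (nth 0 (word t)) (flatten cs)); last first.
  rewrite -[RHS]map_comp; apply: eq_word => [|i]; first by rewrite size_map size_iota.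
  rewrite (nth_map 0) ?size_iota // nth_iota // add0n /=.
  have cs_i : (i : nat) \in flatten cs by rewrite (perm_mem perm_cs) mem_iota /= ltn_ord.
  by rewrite (nth_map 0) ?index_mem // nth_index // nth_word.
have {perm_cs} : {subset cs <= cs} by [].
elim: {1 3 4}cs => [|c cs' IHcs] sub /=; first by rewrite inE.
apply/allpairsP; exists (map (nth 0 (word t)) c, map (nth 0 (word t)) (flatten cs')).
split; last by rewrite map_cat.
  have cs_c : c \in cs by apply: sub; rewrite mem_head.
  have /andP[/eqP def_c /eqP len_c] := cyc_cs c cs_c; rewrite -def_w in def_c len_c.
  have lt_c : head 0 c < n by apply: lt_cs => //; rewrite -len_c.
  apply/mapP; exists (nth 0 (word t) (head 0 c)).
    by have [lt_t len_t] := csz _ lt_c; rewrite mem_filter len_t len_c eqxx mem_iota.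
  apply: (@eq_from_nth _ 0) => [|e]; rewrite size_map ?size_traject // => lt_e.
  rewrite (nth_map 0) //.
  have -> : nth 0 c e = iter e (nth 0 (word s)) (head 0 c).
    by rewrite {1}def_c (set_nth_default (head 0 c)) ?size_traject // nth_traject.
  rewrite [RHS](set_nth_default (nth 0 (word t) (head 0 c))) ?size_traject // nth_traject //.
  exact: (tX (Ordinal lt_c)).
by apply: IHcs => d cs'_d; apply: sub; rewrite inE cs'_d orbT.
Qed.

Definition of_word n w : {perm 'I_n} := odflt 1 [pick s | word s == w].

Lemma of_wordK n w : is_word n w -> word (of_word n w) = w.
Proof.
move=> /is_wordP[s def_w]; rewrite /of_word.
by case: pickP => [t /eqP//|/(_ s)]; rewrite def_w eqxx.
Qed.

Definition of_cycles n cs : {perm 'I_n} := of_word n (wcycles n cs).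

Lemma word_of_cycles n cs : cycles_ok n cs -> word (of_cycles n cs) = wcycles n cs.
Proof. by case/and3P=> ok_w _ _; apply: of_wordK. Qed.

Definition commuting_words ws := all (fun u => all (wcommute u) ws) ws.

Lemma abelian_cent_words n cs (s : {perm 'I_n}) :
    cycles_ok n cs -> word s = wcycles n cs ->
    commuting_words (centralizer_words n cs) ->
  abelian 'C[s].
Proof.
move=> ok_cs def_s /allP cw; apply/centsP=> t /cent1P cst u /cent1P csu.
have Ct := centralizer_words_complete ok_cs def_s (commute_sym cst).
have Cu := centralizer_words_complete ok_cs def_s (commute_sym csu).
by apply/wcommuteP; apply: (allP (cw _ Ct)).
Qed.

Lemma abelian_cent_Alt_words n cs (s : {perm 'I_n}) :
    cycles_ok n cs -> word s = wcycles n cs ->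
    commuting_words [seq w <- centralizer_words n cs | ~~ wodd n w] ->
  abelian 'C_('Alt_('I_n))[s].
Proof.
move=> ok_cs def_s /allP cw.
have inC t : t \in 'C_('Alt_('I_n))[s] ->
    word t \in [seq w <- centralizer_words n cs | ~~ wodd n w].
  case/setIP=> At /cent1P cst; rewrite mem_filter odd_word -Alt_even At.
  exact: centralizer_words_complete (commute_sym cst).
apply/centsP=> t /inC Ct u /inC Cu.
by apply/wcommuteP; apply: (allP (cw _ Ct)).
Qed.

Lemma wlen_all n (s : {perm 'I_n}) w (P : pred nat) (i : 'I_n) :
  word s = w -> all (fun i => P (wlen w i)) (iota 0 n) -> P #|porbit s i|.
Proof. by move=> <- /allP/(_ i); rewrite mem_iota ltn_ord wlen_word; apply. Qed.

Lemma word_join m k (a : {perm 'I_m}) (f : {perm 'I_k}) :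
  word (join_perm a f) = word a ++ map (addn m) (word f).
Proof.
apply: eq_word => [|i]; first by rewrite size_cat size_map !size_word.
rewrite nth_cat size_word; case: (split_ordP i) => j ->.
  by rewrite join_perm_lshift; apply: nth_word.
rewrite join_perm_rshift /= addKn (nth_map 0) ?size_word //.
by rewrite nth_word.
Qed.

Lemma word_rot_perm n : word (rot_perm n) = [seq i.+1 %% n | i <- iota 0 n].
Proof.
apply: eq_word => [|i]; first by rewrite size_map size_iota.
by rewrite (nth_map 0) ?size_iota // nth_iota // permE.
Qed.

(** * Cycle types *)

(** Partitions of n with parts at most m; k is the multiplicity of m. *)
Fixpoint parts_upto m n : seq (seq nat) :=
  if m is m'.+1 then
    flatten [seq [seq nseq k m ++ p | p <- parts_upto m' (n - k * m)]
            | k <- iota 0 (n %/ m).+1]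
  else if n == 0 then [:: [::]] else [::].

Definition partitions n := parts_upto n n.

(** A decreasing sequence is the block of its copies of m + 1 followed by the
    rest. *)
Lemma mem_parts_upto m n p :
    sorted geq p -> all (fun k => 0 < k <= m) p -> sumn p = n -> p \in parts_upto m n.
Proof.
have geq_tr : transitive geq by move=> x y z /= le1 le2; apply: leq_trans le2 le1.
elim: m n p => [|m IHm] n p sp ap <- {n}.
  by case: p sp ap => //= k p _ /andP[/andP[]]; case: k.
pose k := count_mem m.+1 p; pose p' := [seq i <- p | i != m.+1].
have def_p : p = nseq k m.+1 ++ p'.
  have perm_p : perm_eq p (nseq k m.+1 ++ p').
    rewrite -(perm_filterC (pred1 m.+1) p) perm_sym; apply: perm_cat => //.
    by rewrite /k -size_filter -(all_pred1P _ _ (filter_all _ _)).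
  apply: (sorted_eq geq_tr _ sp _ perm_p).
    by move=> x y /= ; rewrite -eqn_leq => /eqP.
  have sp' : sorted geq p' by apply: sorted_filter.
  rewrite sorted_pairwise // pairwise_cat -!sorted_pairwise // sp' andbT.
  apply/andP; split.
    apply/allrelP=> x y /nseqP[-> _]; rewrite mem_filter => /andP[_ py].
    by have /andP[] := allP ap y py.
  by elim: (k) => //= -[|j] //= ->; rewrite leqnn.
have szp : sumn p = k * m.+1 + sumn p' by rewrite {1}def_p sumn_cat sumn_nseq mulnC.
rewrite [parts_upto _ _](erefl (flatten _)).
apply/flattenP; exists [seq nseq k m.+1 ++ q | q <- parts_upto m (sumn p - k * m.+1)].
  apply/mapP; exists k => //; rewrite mem_iota /= ltnS leq_divRL // szp.
  exact: leq_addr.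
apply/mapP; exists p' => //; apply: IHm.
- exact: sorted_filter.
- apply/allP=> i; rewrite mem_filter => /andP[ne_i /(allP ap)/andP[-> /=]].
  by rewrite leq_eqVlt (negPf ne_i).
- by rewrite szp addKn.
Qed.

Definition blocks p := reshape p (iota 0 (sumn p)).

(** Numbering the entries of the cycles consecutively turns f into the
    permutation with consecutive blocks of the same lengths. *)
Lemma cycle_image_blocks (T : eqType) (x0 : T) (f : T -> T) (cs : seq (seq T)) i :
    {in cs, forall c j, j < size c -> f (nth x0 c j) = nth (head x0 c) c j.+1} ->
    i < size (flatten cs) ->
  let j := cycle_image (blocks (shape cs)) i in
  j < size (flatten cs) /\ nth x0 (flatten cs) j = f (nth x0 (flatten cs) i).
Proof.
move=> fcs lt_i; pose e := flatten cs.
have sz_e : sumn (shape cs) = size e by rewrite size_flatten.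
pose bs := blocks (shape cs).
have map_bs : map (map (nth x0 e)) bs = cs.
  rewrite /bs /blocks map_reshape sz_e.
  have -> : map (nth x0 e) (iota 0 (size e)) = e by rewrite map_nth_iota0 ?take_size.
  by rewrite flattenK.
have flat_bs : flatten bs = iota 0 (size e) by rewrite reshapeKr ?size_iota // sz_e.
rewrite /= -/bs -/e.
have : i \in flatten bs by rewrite flat_bs mem_iota.
have : {subset bs <= bs} by [].
elim: {1 3 4 5}bs => [|b bs' IHbs] sub //=.
rewrite mem_cat; have [bi _|nbi] := boolP (i \in b); last first.
  by apply: IHbs => c bs'c; apply: sub; rewrite inE bs'c orbT.
have bs_b : b \in bs by apply: sub; rewrite mem_head.
have cs_b : map (nth x0 e) b \in cs by rewrite -map_bs map_f.
case: b bi bs_b cs_b {sub} => // b0 b bi bs_b cs_b; set b' := b0 :: b in bi bs_b cs_b *.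
have lt_b k : k \in b' -> k < size e.
  move=> b'k; have : k \in flatten bs by apply/flattenP; exists b'.
  by rewrite flat_bs mem_iota.
have := fcs _ cs_b (index i b'); rewrite size_map index_mem => /(_ bi).
rewrite (nth_map 0) ?index_mem // nth_index // => ->.
have [lt_j|le_j] := ltnP (index i b').+1 (size b'); last first.
  rewrite nth_default // [RHS]nth_default ?size_map //=; split=> //.
  by apply: lt_b; rewrite mem_head.
rewrite (set_nth_default 0) // [RHS](set_nth_default x0) ?size_map // (nth_map 0) //.
by split=> //; apply/lt_b/mem_nth.
Qed.

(** Enumerate the points cycle by cycle, in order of decreasing length, and
    conjugate by this enumeration. *)
Lemma canonical_conj n (s : {perm 'I_n}) :
  exists2 p, p \in partitions n & exists t, word (s ^ t) = wcycles n (blocks p).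
Proof.
pose os := sort (fun A B : {set 'I_n} => #|B| <= #|A|) (enum (porbits s)).
pose cyc (A : {set 'I_n}) := if [pick x in A] is Some x then traject s x #|A| else [::].
pose cs := map cyc os; pose e := flatten cs; pose p := shape cs.
have os_orb A : A \in os -> exists2 x, x \in A & cyc A = traject s x #|A| /\ A = porbit s x.
  rewrite mem_sort mem_enum => /imsetP[x0 _ ->]; rewrite /cyc.
  case: pickP => [x Ax|/(_ x0)]; last by rewrite porbit_id.
  by exists x => //; split=> //; apply/eqP; rewrite eq_porbit_mem porbit_sym.
have mem_cyc A : A \in os -> cyc A =i A.
  by move=> /os_orb[x _ [-> ->]] y; rewrite porbit_traject.
have sz_cyc A : A \in os -> size (cyc A) = #|A|.
  by case/os_orb=> x _ [-> _]; rewrite size_traject.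
have def_p : p = [seq #|(A : {set 'I_n})| | A <- os].
  by rewrite /p /shape -map_comp; apply/eq_in_map => A /sz_cyc.
have os_s i : porbit s i \in os by rewrite mem_sort mem_enum imset_f.
have mem_e i : i \in e.
  apply/flattenP; exists (cyc (porbit s i)); first exact: map_f.
  by rewrite mem_cyc ?porbit_id.
have sz_e : size e = n.
  rewrite size_flatten -/p def_p sumnE big_map (perm_big (enum (porbits s))); last first.
    by rewrite perm_sort.
  rewrite big_enum /= -[RHS]card_ord -cardsT.
  apply/esym/card_partition/and3P; split.
  - rewrite eqEsubset subsetT; apply/subsetP=> i _; apply/bigcupP.
    by exists (porbit s i); rewrite ?imset_f ?porbit_id.
  - apply/trivIsetP=> _ _ /imsetP[x _ ->] /imsetP[y _ ->].
    apply: contraR => /pred0Pn[z /andP[xz yz]].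
    by rewrite /= -!eq_porbit_mem in xz yz; rewrite -(eqP xz) (eqP yz).
  - by apply/imsetP=> -[x _ /setP/(_ x)]; rewrite porbit_id inE.
have uniq_e : uniq e.
  apply/card_uniqP; rewrite sz_e -[RHS]card_ord; apply: eq_card => i.
  by rewrite mem_e.
have sum_p : sumn p = n by rewrite -size_flatten -/e sz_e.
exists p.
  apply: mem_parts_upto => //.
    rewrite def_p sorted_map /=.
    by apply: sort_sorted => A B; apply: leq_total.
  apply/allP=> k; rewrite def_p => /mapP[A /os_orb[x Ax _] ->].
  apply/andP; split; first by apply/card_gt0P; exists x.
  by rewrite (leq_trans (max_card _)) ?card_ord.
have h_inj : injective (fun i : 'I_n => nth i e i).
  move=> i j; rewrite (set_nth_default i (j : 'I_n)) ?sz_e // => /eqP.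
  by rewrite nth_uniq ?sz_e // => /eqP/val_inj.
pose h := perm h_inj; exists h^-1.
apply: eq_word => [|i]; first by rewrite size_map size_iota.
rewrite (nth_map 0) ?size_iota // nth_iota // add0n conjgE invgK !permM.
have [||lt_j] := @cycle_image_blocks _ i s cs i; rewrite -/e ?sz_e //.
  move=> _ /mapP[A osA ->] j lt_j; have [x Ax [def_c def_A]] := os_orb A osA.
  rewrite sz_cyc // in lt_j.
  rewrite def_c (set_nth_default x) ?size_traject // nth_traject // -iterS.
  have -> : head i (traject s x #|A|) = x by case: #|A| lt_j.
  have [lt_j1|] := ltnP j.+1 #|A|; first by rewrite nth_traject.
  rewrite leq_eqVlt ltnNge lt_j orbF => /eqP eq_j.
  by rewrite -eq_j nth_default ?size_traject // def_A iter_porbit.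
rewrite sz_e in lt_j; set j := cycle_image _ _ in lt_j * => def_j.
suff -> : s (h i) = h (Ordinal lt_j) by rewrite permK.
by rewrite !permE -def_j; apply: set_nth_default; rewrite sz_e.
Qed.

(** Both permutations have the canonical form of some partition, and the hypothesis
    says that the invariant separates partitions. *)
Lemma ctype_class n (s t : {perm 'I_n}) :
    uniq [seq ctype (wcycles n (blocks p)) | p <- partitions n] ->
    ctype (word s) = ctype (word t) -> exists u, t = s ^ u.
Proof.
move=> uniq_ct; have [p pn [u def_u]] := canonical_conj s.
have [q qn [v def_v]] := canonical_conj t.
rewrite -(ctype_conj s u) -(ctype_conj t v) def_u def_v => eq_ct.
have [f injf] : exists f, {in partitions n, cancel (fun p => ctype (wcycles n (blocks p))) f}.
  exists (fun c => nth [::] (partitions n)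
    (index c [seq ctype (wcycles n (blocks p)) | p <- partitions n])).
  move=> p' p'n /=; rewrite -{1}(nth_index [::] p'n).
  rewrite -(nth_map [::] [::] (fun p => ctype (wcycles n (blocks p)))) ?index_mem //.
  by rewrite index_uniq ?size_map ?index_mem // nth_index.
have eq_pq : p = q by rewrite -(injf p pn) -(injf q qn) eq_ct.
exists (u * v^-1); rewrite conjgM.
have -> : s ^ u = t ^ v by apply: word_inj; rewrite def_u def_v eq_pq.
by rewrite conjgK.
Qed.

(** * The pentagon obstruction *)

(** The size of a largest clique either avoids x or is one more than that of a
    clique among the neighbours of x.  The fuel bounds the length of L. *)
Fixpoint max_clique (T : Type) (r : rel T) fuel (L : seq T) : nat :=
  match fuel, L with
  | fuel'.+1, x :: L' =>
      maxn (max_clique r fuel' L') (max_clique r fuel' [seq y <- L' | r x y]).+1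
  | _, _ => 0
  end.

Lemma leq_max_clique (T : eqType) (r : rel T) fuel (L D : seq T) :
    size L <= fuel -> uniq D -> {subset D <= L} ->
    {in D &, forall x y, x != y -> r x y} ->
  size D <= max_clique r fuel L.
Proof.
elim: fuel L D => [|fuel IHf] [|x L] D //= szL uD sDL rD.
- by rewrite leqn0 size_eq0; case: D sDL {uD rD} => // x D /(_ x); rewrite mem_head => /(_ isT).
- by case: D sDL {uD rD} => // x D /(_ x); rewrite mem_head => /(_ isT).
rewrite leq_max; have [Dx|nDx] := boolP (x \in D); last first.
  apply/orP; left; apply: IHf => // y Dy.
  by have:= sDL y Dy; rewrite inE => /predU1P[def_y|//]; rewrite -def_y Dy in nDx.
apply/orP; right; rewrite (perm_size (perm_to_rem Dx)) /= ltnS.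
apply: IHf => [||y|y z].
- by rewrite size_filter (leq_trans (count_size _ _)).
- exact: rem_uniq.
- rewrite mem_rem_uniq // inE => /andP[ne_yx Dy]; rewrite mem_filter rD // 1?eq_sym //.
  by have:= sDL y Dy; rewrite inE (negPf ne_yx).
by move=> /mem_rem Dy /mem_rem Dz; apply: rD.
Qed.

Lemma size_le_words n (D : {set {perm 'I_n}}) (r : rel (seq nat)) L :
    (forall s, s \in D -> word s \in L) ->
    {in D &, forall s t, s != t -> r (word s) (word t)} ->
  #|D| <= max_clique r (size L) L.
Proof.
move=> sDL rD; rewrite cardE -(size_map (@word n)); apply: leq_max_clique => //.
- by rewrite (map_inj_uniq (@word_inj n)) enum_uniq.
- by move=> _ /mapP[s Ds ->]; apply: sDL; rewrite mem_enum in Ds.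
move=> _ _ /mapP[s Ds ->] /mapP[t Dt ->]; rewrite !mem_enum in Ds Dt.
by rewrite (inj_eq (@word_inj n)); apply: rD.
Qed.

Section ClassSelection.

Variables (gT : finGroupType) (G : {group gT}) (v0 : gT) (L : seq gT) (p c : nat).
Let A := v0 ^: G.

(** L plays the pentagon: its non-commuting subsets have at most p elements, the
    commuting subsets of the class at most c.  The image I of r is non-commuting, so
    counting the pairs (x, g) with x in L and x ^ g in I gives
    size L * #|I| <= p * #|A|; the fibres of r are commuting, so #|A| <= c * #|I|.
    Together size L <= p * c. *)
Lemma class_no_selection (r : gT -> gT) :
    v0 \in G -> uniq L -> {subset L <= A} ->
    (forall D : {set gT}, {subset D <= L} ->
       {in D &, forall x y : gT, commute x y -> x = y} -> #|D| <= p) ->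
    (forall D : {set gT}, D \subset A -> {in D &, forall x y : gT, commute x y} -> #|D| <= c) ->
    p * c < size L ->
    {in A, forall x, r x \in A} ->
    ~ {in A &, forall x y : gT, commute (r x) (r y) -> r x = r y /\ commute x y}.
Proof.
move=> Gv0 uniqL sLA boundL boundA ltpc rA rP.
pose I := r @: A.
have ncI : {in I &, forall x y : gT, commute x y -> x = y}.
  by move=> _ _ /imsetP[x Ax ->] /imsetP[y Ay ->] /(rP x y Ax Ay)[].
have sIA : I \subset A by apply/subsetP=> _ /imsetP[x Ax ->]; apply: rA.
have leA : #|A| <= c * #|I|.
  rewrite -sum1_card (partition_big_imset r) /= -/I.
  rewrite mulnC -sum_nat_const; apply: leq_sum => y Iy.
  rewrite sum1dep_card; apply: boundA => [|a b].
    by apply/subsetP=> x; rewrite inE => /andP[].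
  rewrite !inE => /andP[Aa /eqP ra] /andP[Ab /eqP rb].
  by have [] := rP a b Aa Ab _; rewrite // ra rb.
(* The elements conjugating x to b form a coset of the centraliser of x. *)
have fib x b : x \in A -> b \in A -> #|[set g in G | x ^ g == b]| = #|'C_G[v0]|.
  case/imsetP=> h Gh ->; case/imsetP=> k Gk ->.
  transitivity #|h^-1 *: ('C_G[v0] :* k)|; last by rewrite card_lcoset card_rcoset.
  apply: eq_card => g; rewrite mem_lcoset invgK mem_rcoset inE in_setI.
  have -> : (h * g * k^-1 \in G) = (g \in G) by rewrite groupMr ?groupV // groupMl.
  case Gg: (g \in G) => //=; apply/eqP/cent1P => [eq_g|].
    by apply/commute_sym/commgP/conjg_fixP; rewrite !conjgM eq_g -conjgM mulgV conjg1.
  by move/commute_sym/commgP/conjg_fixP; rewrite !conjgM => /(canRL (conjgKV k)).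
have AG : (#|A| * #|'C_G[v0]| = #|G|)%N.
  by rewrite -index_cent1 mulnC Lagrange // subsetIl.
have leI : size L * #|I| <= p * #|A|.
  rewrite -(leq_pmul2r (cardG_gt0 'C_G[v0]%G)) -!mulnA AG.
  have -> : (size L * (#|I| * #|'C_G[v0]%G|) = \sum_(g in G) #|[set x in L | (x ^ g)%g \in I]|)%N.
    transitivity (\sum_(x in L) \sum_(b in I) #|[set g in G | (x ^ g)%g == b]|)%N.
      transitivity (\sum_(x in L) #|I| * #|'C_G[v0]|)%N.
        by rewrite sum_nat_const (card_uniqP uniqL).
      apply: eq_bigr => x Lx; rewrite -sum_nat_const; apply: eq_bigr => b Ib.
      by rewrite (fib x b (sLA x Lx) (subsetP sIA b Ib)).
    transitivity (\sum_(x in L) \sum_(g in G) ((x ^ g)%g \in I))%N.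
      apply: eq_bigr => x Lx; transitivity (\sum_(b in I) \sum_(g in G) ((x ^ g)%g == b))%N.
        by apply: eq_bigr => b _; rewrite -sum1dep_card big_mkcondr.
      rewrite exchange_big; apply: eq_bigr => g _ /=.
      rewrite -big_mkcondr /= sum1dep_card.
      have [Ib|nIb] := boolP (x ^ g \in I).
        rewrite (_ : [set _ | _] = [set x ^ g]) ?cards1 //; apply/setP=> b; rewrite !inE eq_sym.
        by case: eqP => [->|]; rewrite ?andbF ?Ib.
      rewrite (_ : [set _ | _] = set0) ?cards0 //; apply/setP=> b; rewrite !inE.
      by case: eqP => [<-|]; rewrite ?andbF // (negPf nIb).
    rewrite exchange_big; apply: eq_bigr => g _ /=.
    by rewrite -big_mkcondr sum1dep_card.
  rewrite mulnC -sum_nat_const; apply: leq_sum => g Gg.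
  apply: boundL => [x|x y]; first by rewrite inE => /andP[].
  rewrite !inE => /andP[_ Ix] /andP[_ Iy] cxy; apply: (conjg_inj g).
  by apply: ncI => //; rewrite /commute -!conjMg cxy.
have I0 : 0 < #|I|.
  by apply/card_gt0P; exists (r v0); apply: imset_f; apply: class_refl.
have := leq_trans leI (leq_mul (leqnn p) leA).
by rewrite mulnA leq_pmul2r // leqNgt ltpc.
Qed.

End ClassSelection.

(** * Inequality *)

Lemma Alt_conj n (x t : {perm 'I_n}) : (x ^ t \in 'Alt_('I_n)) = (x \in 'Alt_('I_n)).
Proof. by rewrite !Alt_even odd_permJ. Qed.

Lemma abelian_cent_Alt_conj n (y t : {perm 'I_n}) :
  abelian 'C_('Alt_('I_n))[y] -> abelian 'C_('Alt_('I_n))[y ^ t].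
Proof.
move=> abC; have -> : 'C_('Alt_('I_n))[y ^ t] = 'C_('Alt_('I_n))[y] :^ t.
  rewrite conjIg cent1J; congr (_ :&: _); apply/esym/normP.
  by apply: (subsetP (normal_norm (Alt_normal _))); rewrite inE.
by rewrite abelianJ.
Qed.

Definition cycles321 : seq (seq nat) := [:: [:: 0; 1; 2]; [:: 3; 4]; [:: 5]; [:: 6]; [:: 7]]%N.
Definition perm321 := of_cycles 8 cycles321.
Definition class321 := perm321 ^: [set: {perm 'I_8}].

Lemma cycles321_ok : cycles_ok 8 cycles321.
Proof. by vm_compute. Qed.

Lemma word_perm321 : word perm321 = wcycles 8 cycles321.
Proof. exact: word_of_cycles cycles321_ok. Qed.

Lemma class321_ctype b : (b \in class321) = (ctype (word b) == ctype (wcycles 8 cycles321)).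
Proof.
rewrite -word_perm321; apply/imsetP/eqP=> [[g _ ->]|eq_ct]; first by rewrite ctype_conj.
have [|g def_b] := ctype_class _ (esym eq_ct); first by vm_compute.
by exists g.
Qed.

(** The five transpositions form a 5-cycle of the Petersen graph on the pairs of
    points of {3, ..., 7}; both orientations of the 3-cycle are kept, since a
    commuting set may contain both. *)
Definition pentagon : seq (seq (seq nat)) :=
  [seq c :: s :: [seq [:: i] | i <- iota 3 5 & i \notin s] |
    c <- [:: [:: 0; 1; 2]; [:: 0; 2; 1]],
    s <- [:: [:: 3; 4]; [:: 5; 6]; [:: 7; 3]; [:: 4; 5]; [:: 6; 7]]]%N.

Lemma pentagon_ok :
  all (fun cs => cycles_ok 8 cs && (ctype (wcycles 8 cs) == ctype (wcycles 8 cycles321)))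
    pentagon.
Proof. by vm_compute. Qed.

Lemma pentagon_uniq : uniq (map (wcycles 8) pentagon).
Proof. by vm_compute. Qed.

Lemma pentagon_clique : let L := map (wcycles 8) pentagon in
  max_clique (fun u v => ~~ wcommute u v) (size L) L <= 2.
Proof. by vm_compute. Qed.

(** After conjugation a commuting subset contains perm321, so it is enough to look
    inside its centraliser. *)
Lemma class321_clique :
  let L := [seq b <- centralizer_words 8 cycles321 | ctype b == ctype (wcycles 8 cycles321)] in
  max_clique wcommute (size L) L <= 4.
Proof. by vm_compute. Qed.


(** Here 10 = size of the pentagon exceeds 2 * 4. *)
Lemma class321_no_selection (r : {perm 'I_8} -> {perm 'I_8}) :
  {in class321, forall a, r a \in class321} ->
  ~ {in class321 &, forall a b, commute (r a) (r b) -> r a = r b /\ commute a b}.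
Proof.
have okP cs : cs \in pentagon ->
    word (of_cycles 8 cs) = wcycles 8 cs /\ of_cycles 8 cs \in class321.
  move=> /(allP pentagon_ok)/andP[ok_cs ct_cs].
  by rewrite class321_ctype (word_of_cycles ok_cs).
move: pentagon_uniq pentagon_clique okP (erefl : size pentagon = 10).
move: pentagon => P uniqP cliqueP okP szP.
pose L := map (of_cycles 8) P.
have defL : map (@word 8) L = map (wcycles 8) P.
  by rewrite -map_comp; apply/eq_in_map => cs /okP[].
have LA : {subset L <= class321} by move=> _ /mapP[cs /okP[_ Acs] ->].
apply: (@class_no_selection _ [set: {perm 'I_8}]%G perm321 L 2 4) LA _ _ _.
- exact: in_setT.
- by rewrite -(map_inj_uniq (@word_inj 8)) defL.
- move=> D sDL ncD; apply: leq_trans cliqueP; apply: size_le_words => [s /sDL Ls|s t Ds Dt].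
    by rewrite -defL map_f.
  by apply: contra => /wcommuteP/(ncD s t Ds Dt)/eqP.
- move=> D sDA cD; case: (set_0Vmem D) => [->|[d Dd]]; first by rewrite cards0.
  have /imsetP[g _ def_d] := subsetP sDA d Dd.
  rewrite -(cardJg D g^-1); apply: leq_trans class321_clique.
  have cD' : {in D :^ g^-1 &, forall s t, commute s t}.
    move=> _ _ /imsetP[s Ds ->] /imsetP[t Dt ->].
    by rewrite /commute -!conjMg (cD s t).
  apply: size_le_words => [s Ds|s t Ds Dt _]; last by apply/wcommuteP/cD'.
  rewrite mem_filter; apply/andP; split.
    case/imsetP: Ds => t Dt ->; rewrite ctype_conj -class321_ctype.
    exact: (subsetP sDA).
  apply: (centralizer_words_complete cycles321_ok word_perm321).
  by apply: cD' => //; rewrite mem_conjgV -def_d.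
by rewrite size_map szP.
Qed.

(** For each a in the class the value of q at join_perm a f is join_perm b h with b
    in the class, since the second alternative contradicts [selector_abelian_cent].
    The map a |-> b separates the class as q does, because the factors h lie in the
    abelian group 'C[f]. *)
Lemma no_selector_join k (f : {perm 'I_k}) q :
    odd_perm f -> abelian 'C[f] ->
    (forall m, m \in 'Alt_('I_(8 + k)) -> commute (join_perm perm321 f) m ->
      (exists b h, [/\ b \in class321, commute h f & m = join_perm b h]) \/
      (exists y, [/\ y \in 'Alt_('I_(8 + k)), abelian 'C_('Alt_('I_(8 + k)))[y],
         commute m y & ~ commute (join_perm perm321 f) y])) ->
  ~ selector 'Alt_('I_(8 + k)) q.
Proof.
move=> odd_f ab_f escape selq; have [Gq cq qP] := selq.
have odd_A a : a \in class321 -> odd_perm a.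
  by case/imsetP=> g _ ->; rewrite odd_permJ -odd_word word_perm321; vm_compute.
have G_x a : a \in class321 -> join_perm a f \in 'Alt_('I_(8 + k)).
  by move=> Aa; rewrite Alt_even odd_join_perm odd_A // odd_f.
(* The alternatives for perm321 are transported to a by conjugation. *)
have q_x a : a \in class321 ->
    exists2 b, b \in class321 & exists2 h, h \in 'C[f] & q (join_perm a f) = join_perm b h.
  move=> Aa; case/imsetP: (Aa) => g _ def_a; pose t := join_perm g (1 : {perm 'I_k}).
  have def_x : join_perm a f = join_perm perm321 f ^ t.
    apply: (mulgI t); rewrite conjgE !mulgA mulgV mul1g.
    by rewrite !join_permM def_a mul1g mulg1 conjgE !mulgA mulgV mul1g.
  have Gqt : q (join_perm a f) ^ t^-1 \in 'Alt_('I_(8 + k)).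
    by rewrite Alt_even odd_permJ -Alt_even Gq ?G_x.
  have cqt : commute (join_perm perm321 f) (q (join_perm a f) ^ t^-1).
    have def_q : q (join_perm a f) = (q (join_perm a f) ^ t^-1) ^ t by rewrite conjgKV.
    move: def_q; set m := _ ^ t^-1 => def_q; apply: (conjg_inj t).
    by rewrite (conjMg _ m) (conjMg m) -def_q -def_x; apply/cq/G_x.
  case: (escape _ Gqt cqt) => [[b [h [Ab cfh def_m]]]|[y [Gy abC cmy ncy]]].
    exists (b ^ g); first by case/imsetP: Ab => b' _ ->; rewrite -conjgM; apply: imset_f.
    exists h; first exact/cent1P.
    move/(canRL (conjgKV t)): def_m => ->; apply: (mulgI t).
    rewrite conjgE !mulgA mulgV mul1g.
    by rewrite !join_permM mul1g mulg1 conjgE !mulgA mulgV mul1g.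
  have cxy : commute (join_perm a f) (y ^ t).
    apply: (selector_abelian_cent selq) (G_x a Aa) _ _ _.
    - by rewrite Alt_even odd_permJ -Alt_even.
    - exact: abelian_cent_Alt_conj.
    have def_q : q (join_perm a f) = (q (join_perm a f) ^ t^-1) ^ t by rewrite conjgKV.
    by move: cmy def_q; set m := _ ^ t^-1 => cmy ->; rewrite /commute -!conjMg cmy.
  case: ncy; apply: (conjg_inj t); rewrite !conjMg -def_x; exact: cxy.
pose r a := odflt 1 [pick b in class321 |
  [exists h in 'C[f], q (join_perm a f) == join_perm b h]].
have rP a : a \in class321 ->
    r a \in class321 /\ exists2 h, h \in 'C[f] & q (join_perm a f) = join_perm (r a) h.
  move=> /q_x[b Ab [h Ch def_q]]; rewrite /r.
  case: pickP => [b' /andP[Ab' /exists_inP[h' Ch' /eqP def_q']]|/(_ b)].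
    by split; last exists h'.
  by rewrite Ab => /exists_inP[]; exists h => //; apply/eqP.
apply: (@class321_no_selection r) => [a /rP[]//|a b Aa Ab crr].
have [Ara [h Ch def_qa]] := rP a Aa; have [Arb [h' Ch' def_qb]] := rP b Ab.
have cqq : commute (q (join_perm a f)) (q (join_perm b f)).
  rewrite def_qa def_qb; apply/commute_join_perm; split=> //.
  exact: (centsP ab_f).
have [eq_q cab] := qP _ _ (G_x a Aa) (G_x b Ab) cqq.
split; last by have [] := (commute_join_perm a b f f).1 cab.
by move: eq_q; rewrite def_qa def_qb => /join_perm_inj[].
Qed.

(** Elements of types (6, 1, 1) and (4, 3, 1).  Each b commuting with perm321 and
    outside its class commutes with one of them that does not commute with
    perm321. *)
Definition escapes8 : seq (seq (seq nat)) :=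
  [:: [:: [:: 0; 5; 1; 6; 2; 7]; [:: 3]; [:: 4]];
      [:: [:: 0; 5; 1; 7; 2; 6]; [:: 3]; [:: 4]];
      [:: [:: 0; 1; 2; 3; 4; 5]; [:: 6]; [:: 7]];
      [:: [:: 0; 1; 2; 3; 4; 6]; [:: 5]; [:: 7]];
      [:: [:: 0; 1; 2; 3; 4; 7]; [:: 5]; [:: 6]];
      [:: [:: 0; 1; 2]; [:: 3; 5; 4; 6]; [:: 7]];
      [:: [:: 0; 1; 2]; [:: 3; 5; 4; 7]; [:: 6]];
      [:: [:: 0; 1; 2]; [:: 3; 6; 4; 7]; [:: 5]];
      [:: [:: 5; 6; 7]; [:: 1; 2; 3; 4]; [:: 0]]]%N.

Lemma escapes8_ok :
  all (fun ys => [&& cycles_ok 8 ys, wodd 8 (wcycles 8 ys),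
      commuting_words (centralizer_words 8 ys) &
      all (fun i => wlen (wcycles 8 ys) i \in [:: 1; 3; 4; 6]%N) (iota 0 8)]) escapes8.
Proof. by vm_compute. Qed.

Lemma escapes8_cover :
  all (fun b => (ctype b == ctype (wcycles 8 cycles321)) ||
    has (fun ys => wcommute b (wcycles 8 ys) &&
                   ~~ wcommute (wcycles 8 cycles321) (wcycles 8 ys)) escapes8)
  (centralizer_words 8 cycles321).
Proof. by vm_compute. Qed.

Lemma card_porbit_perm321 (i : 'I_8) : #|porbit perm321 i| \in [:: 1; 2; 3]%N.
Proof. by apply: (wlen_all (P := mem [:: 1; 2; 3]%N) i word_perm321); vm_compute. Qed.

Lemma no_selector_large k (f : {perm 'I_k}) q :
    odd_perm f -> abelian 'C[f] ->
    (forall v, #|porbit f v| \notin [:: 1; 2; 3; 4; 6]%N) ->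
  ~ selector 'Alt_('I_(8 + k)) q.
Proof.
move=> odd_f ab_f sz_f; apply: no_selector_join (odd_f) (ab_f) _ => m Gm cxm.
have neq_size u v : #|porbit perm321 u| != #|porbit f v|.
  have := card_porbit_perm321 u; apply: contraL => /eqP->; apply: contra (sz_f v).
  by rewrite !inE => /or3P[]->; rewrite ?orbT.
have [b [h [def_m cba chf]]] := commute_join_permP neq_size (commute_sym cxm).
have := centralizer_words_complete cycles321_ok word_perm321 (commute_sym cba).
case/(allP escapes8_cover)/orP=> [ct_b|/hasP[ys ys_e /andP[cby ncay]]].
  by left; exists b, h; rewrite class321_ctype.
have /and4P[ok_y odd_y ab_y sz_y] := allP escapes8_ok ys ys_e.
have def_y := word_of_cycles ok_y; set y := of_cycles 8 ys in def_y.
right; exists (join_perm y f); split.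
- by rewrite Alt_even odd_join_perm -odd_word def_y odd_y odd_f.
- apply: abelianS (subsetIr _ _) _; apply: abelian_cent_join_perm => // [u v|].
    have := wlen_all (P := mem [:: 1; 3; 4; 6]%N) u def_y sz_y.
    apply: contraL => /eqP->; apply: contra (sz_f v).
    by rewrite /= !inE => /or4P[]->; rewrite ?orbT.
  exact: abelian_cent_words ok_y def_y ab_y.
- rewrite def_m; apply/commute_join_perm; split=> //.
  by apply/wcommuteP; rewrite def_y.
case/commute_join_perm=> /wcommuteP.
by rewrite word_perm321 def_y (negPf ncay).
Qed.

Definition cycles4321 : seq (seq nat) := (cycles321 ++ [:: [:: 8; 9; 10; 11]])%N.

(** With the filler (8 9 10 11) the type (4, 3, 1) on the first eight points no longer
    gives an abelian centraliser; elements of types (6, 4, 1, 1), (6, 3, 2, 1),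
    (5, 4, 2, 1) and (5, 3, 2, 2) of A_12 take over, some of them mixing the two sets
    of points. *)
Definition escapes12 : seq (seq (seq nat)) :=
  [:: [:: [:: 0; 5; 1; 6; 2; 7]; [:: 3]; [:: 4]; [:: 8; 9; 10; 11]];
      [:: [:: 0; 5; 1; 7; 2; 6]; [:: 3]; [:: 4]; [:: 8; 9; 10; 11]];
      [:: [:: 0; 1; 2]; [:: 3; 4]; [:: 5]; [:: 6; 8; 9; 7; 10; 11]];
      [:: [:: 0; 1; 2]; [:: 3; 4]; [:: 6]; [:: 5; 8; 9; 7; 10; 11]];
      [:: [:: 0; 1; 2]; [:: 3; 4]; [:: 7]; [:: 5; 8; 9; 6; 10; 11]];
      [:: [:: 0; 1; 2]; [:: 3; 4]; [:: 6; 7]; [:: 5; 8; 9; 10; 11]];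
      [:: [:: 0; 1; 2]; [:: 3; 4]; [:: 5; 7]; [:: 6; 8; 9; 10; 11]];
      [:: [:: 0; 1; 2]; [:: 3; 4]; [:: 5; 6]; [:: 7; 8; 9; 10; 11]];
      [:: [:: 0; 1; 2; 3; 4]; [:: 5; 6; 7]; [:: 8; 9]; [:: 10; 11]];
      [:: [:: 0; 1; 2]; [:: 3; 4; 5; 6; 7]; [:: 8; 9]; [:: 10; 11]];
      [:: [:: 0]; [:: 1; 2; 3; 4; 5]; [:: 6; 7]; [:: 8; 9; 10; 11]];
      [:: [:: 0]; [:: 1; 2; 3; 4; 6]; [:: 5; 7]; [:: 8; 9; 10; 11]];
      [:: [:: 0]; [:: 1; 2; 3; 4; 7]; [:: 5; 6]; [:: 8; 9; 10; 11]]]%N.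

Lemma escapes12_ok :
  all (fun ys => [&& cycles_ok 12 ys, ~~ wodd 12 (wcycles 12 ys) &
      commuting_words [seq w <- centralizer_words 12 ys | ~~ wodd 12 w]]) escapes12.
Proof. by vm_compute. Qed.

(** The first eight letters of a word commuting with that of
    join_perm perm321 (rot_perm 4) describe the factor on eight points. *)
Lemma escapes12_cover :
  all (fun m => [|| wodd 12 m, ctype (take 8 m) == ctype (wcycles 8 cycles321) |
    has (fun ys => wcommute m (wcycles 12 ys) &&
                   ~~ wcommute (wcycles 12 cycles4321) (wcycles 12 ys)) escapes12])
  (centralizer_words 12 cycles4321).
Proof. by vm_compute. Qed.

Lemma cycles4321_ok : cycles_ok 12 cycles4321.
Proof. by vm_compute. Qed.

Lemma word_cycles4321 : word (join_perm perm321 (rot_perm 4)) = wcycles 12 cycles4321.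
Proof. by rewrite word_join word_perm321 word_rot_perm; vm_compute. Qed.

Lemma no_selector12 q : ~ selector 'Alt_('I_12) q.
Proof.
apply: (@no_selector_join 4 (rot_perm 4)) => [||m Gm cxm].
- by rewrite odd_rot_perm.
- exact: abelian_cent_rot_perm.
have neq_size u v : #|porbit perm321 u| != #|porbit (rot_perm 4) v|.
  by rewrite card_porbit_rot_perm; apply: contraL (card_porbit_perm321 u) => /eqP->.
have [b [h [def_m cba chf]]] := commute_join_permP neq_size (commute_sym cxm).
have := centralizer_words_complete cycles4321_ok word_cycles4321 cxm.
case/(allP escapes12_cover)/or3P=> [|ct_b|/hasP[ys ys_e /andP[cmy ncxy]]].
- by rewrite odd_word => odd_m; rewrite Alt_even odd_m in Gm.
- left; exists b, h; split=> //; rewrite class321_ctype.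
  have word_m : @word 12 m = word b ++ map (addn 8) (word h).
    by rewrite -word_join -def_m.
  by move: ct_b; rewrite word_m take_size_cat ?size_word.
have /and3P[ok_y odd_y ab_y] := allP escapes12_ok ys ys_e.
have def_y := word_of_cycles ok_y; set y := of_cycles 12 ys in def_y.
right; exists y; split.
- by rewrite Alt_even -odd_word def_y.
- exact: abelian_cent_Alt_words ok_y def_y ab_y.
- by apply/(@wcommuteP 12); rewrite def_y.
move=> /(@wcommuteP 12).
by rewrite def_y word_cycles4321 (negPf ncxy).
Qed.

(** n = 14 escapes the argument because a filler of length 6 competes with the
    6-cycles used to exclude b, and for odd n < 21 no filler has the required
    lengths. *)
Lemma delta_neq_Delta_Alt n :
  n = 12 \/ n = 16 \/ n = 18 \/ 20 <= n -> delta 'Alt_('I_n)%G <> Delta 'Alt_('I_n)%G.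
Proof.
have odd_rot k : 0 < k -> odd_perm (rot_perm k) = ~~ odd k.
  by case: k => // k _; rewrite odd_rot_perm /= negbK.
have even_case k : 8 <= k -> ~~ odd k ->
    delta 'Alt_('I_(8 + k))%G <> Delta 'Alt_('I_(8 + k))%G.
  move=> k_ge8 even_k /delta_eq_Delta_selector[q]; apply: (@no_selector_large k (rot_perm k)).
  - by rewrite odd_rot // (leq_trans _ k_ge8).
  - exact: abelian_cent_rot_perm.
  move=> v; rewrite card_porbit_rot_perm !inE.
  by rewrite !(gtn_eqF (leq_trans _ k_ge8)).
case=> [-> /delta_eq_Delta_selector[q /no_selector12]//|n_ge].
have n_ge8 : 8 <= n by case: n_ge => [->|[->|/(leq_trans _)->]].
have [odd_n|even_n] := boolP (odd n); last first.
  have k_ge8 : 8 <= n - 8.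
    by case: n_ge => [->|[->|n_ge]] //; rewrite leq_subRL // (leq_trans _ n_ge).
  by rewrite -(subnKC n_ge8); apply: even_case => //; rewrite oddB // (negPf even_n).
have n_ge21 : 21 <= n.
  by case: n_ge odd_n => [->|[->|]] //; rewrite leq_eqVlt => /predU1P[<-|].
have k_ge5 : 5 <= n - 16 by rewrite leq_subRL // (leq_trans _ n_ge21).
have odd_k : odd (n - 16) by rewrite oddB ?odd_n // (leq_trans _ n_ge21).
(* The filler is an 8-cycle times an (n - 16)-cycle. *)
have -> : n = (8 + (8 + (n - 16)))%N by rewrite addnA subnKC // (leq_trans _ n_ge21).
move: (n - 16) k_ge5 odd_k => k k_ge5 odd_k /delta_eq_Delta_selector[q].
have sz u v : #|porbit (rot_perm 8) u| != #|porbit (rot_perm k) v|.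
  by rewrite !card_porbit_rot_perm; apply: contraTneq odd_k => <-.
apply: (no_selector_large (f := join_perm (rot_perm 8) (rot_perm k))).
- by rewrite odd_join_perm !odd_rot ?odd_k // (leq_trans _ k_ge5).
- by apply: abelian_cent_join_perm; rewrite ?abelian_cent_rot_perm.
move=> v; case: (split_ordP v) => u ->.
  by rewrite card_porbit_lshift card_porbit_rot_perm.
rewrite card_porbit_rshift card_porbit_rot_perm !inE.
by apply/negP=> /or4P[| | |/orP[]] /eqP def_k; rewrite def_k in k_ge5 odd_k.
Qed.

(** * Equality *)

Definition canon n p := wcycles n (blocks p).

(** Only a type with few repeated lengths can have an abelian centraliser in A_n;
    at most one repetition is enough for the covers needed below, and keeps the
    centralisers to be enumerated small. *)
Definition nearly_distinct (p : seq nat) := size p <= (size (undup p)).+1.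

(** The two filters are nested, not conjoined, so that evaluation never enumerates the
    centraliser of a type discarded by the first one. *)
Definition abelian_types n :=
  [seq p <- [seq p <- partitions n | nearly_distinct p] | ~~ wodd n (canon n p) &&
    commuting_words [seq w <- centralizer_words n (blocks p) | ~~ wodd n w]].

(** If c has length k and d is a cycle whose m-th power consists of m cycles of
    length k, the result is a cycle whose (m + 1)-st power consists of c and these m
    cycles. *)
Definition interleave (c d : seq nat) : seq nat :=
  flatten [seq p.1 :: p.2 | p <- zip c (reshape (nseq (size c) (size d %/ size c)) d)].

(** All ways of fusing runs of consecutive cycles of equal length into single
    cycles; the original permutation is a product of powers of the fused cycles. *)
Fixpoint fusions (cs : seq (seq nat)) : seq (seq (seq nat)) :=
  if cs is c :: cs' then
    (if size (head [::] cs') == size c then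
       [seq interleave c (head [::] ds) :: behead ds | ds <- fusions cs'] else [::])
    ++ [seq c :: ds | ds <- fusions cs']
  else [:: [::]].

(** extra lists further candidates, for the few types that no fusion covers. *)
Definition covered_type n (yts : seq (seq nat)) extra p :=
  has (fun ys => let y := wcycles n ys in
       [&& is_word n y, wcommute (canon n p) y, ~~ wodd n y & ctype y \in yts])
    [seq ys <- fusions (blocks p) ++ extra | nearly_distinct (map size ys)].

(** Breadth-first enumeration of an orbit, one element of todo per unit of fuel. *)
Fixpoint orbit_list (T S : eqType) (act : T -> S -> T) (gens : seq S)
    fuel (todo seen : seq T) :=
  match fuel, todo with
  | fuel'.+1, x :: todo' =>
      let new := [seq y <- undup [seq act x g | g <- gens] | y \notin seen] in
      orbit_list act gens fuel' (todo' ++ new) (seen ++ new)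
  | _, _ => seen
  end.

Lemma orbit_list_ind (T S : eqType) (act : T -> S -> T) gens (P : T -> Prop) fuel todo seen :
    (forall x g, P x -> g \in gens -> P (act x g)) ->
    (forall x, x \in todo -> P x) -> (forall x, x \in seen -> P x) ->
  forall x, x \in orbit_list act gens fuel todo seen -> P x.
Proof.
move=> Pact; elim: fuel todo seen => [|fuel IHf] [|x todo] seen Ptodo Pseen //=.
set new := [seq y <- _ | _]; have Pnew y : y \in new -> P y.
  rewrite mem_filter mem_undup => /andP[_] /mapP[g gens_g ->].
  by apply: Pact => //; apply/Ptodo/mem_head.
apply: IHf => y; rewrite mem_cat => /orP[y_in|/Pnew//]; last exact: Pseen.
by apply: Ptodo; rewrite inE y_in orbT.
Qed.

(** For a type not covered: permutations ld_syms generating a group under which the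
    orbit of the canonical word is a union of connected components, and pairs
    (m, w), given up to conjugation by ld_shifts, standing for the clique of the
    elements of the orbit that commute with both m and w, with selected value m. *)
Record local_data := LocalData {
  ld_type : seq nat;
  ld_syms : seq (seq (seq nat));
  ld_pairs : seq (seq (seq nat) * seq (seq nat));
  ld_shifts : seq (seq (seq nat)) }.

Section LocalCheck.

Variables (n : nat) (yts uts : seq (seq nat)) (d : local_data).

Let syms := [seq wcycles n h | h <- ld_syms d].
(** 1000 exceeds the size of every orbit considered. *)
Definition local_orbit :=
  orbit_list wconj syms 1000
    [:: canon n (ld_type d)] [:: canon n (ld_type d)].
Definition local_pairs :=
  let ps := [seq (wcycles n p.1, wcycles n p.2) | p <- ld_pairs d] in
  orbit_list (fun mw h => (wconj mw.1 h, wconj mw.2 h))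
    [seq wcycles n h | h <- ld_shifts d] 1000 ps ps.

Definition meets (mw : seq nat * seq nat) x := wcommute x mw.1 && wcommute x mw.2.

(** Closure of the orbit under commutation is only tested at its base point, in the
    fourth clause: the orbit is stable under ld_syms, which act transitively on it.
    The same clause shows that nothing in the orbit commutes with an element having
    one of the types yts. *)
Definition local_check (K : seq (seq nat)) (ms : seq (seq nat * seq nat)) :=
  [&& cycles_ok n (blocks (ld_type d)),
      all (is_word n) syms,
      canon n (ld_type d) \in K,
      all (fun x => all (fun h => wconj x h \in K) syms) K,
      all (fun z => wodd n z ||
        ((ctype z \notin yts) && ((ctype z \in uts) ==> (z \in K))))
        (centralizer_words n (blocks (ld_type d))),
      all (fun mw => mw.1 \in K) ms,
      all (fun x => has (meets^~ x) ms) K,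
      all (fun mw => all (fun mw' => wcommute mw.1 mw'.1 ==> (mw == mw')) ms) ms &
      all (fun mw => commuting_words (filter (meets mw) K)) ms].

End LocalCheck.

Definition selector_check n extra data :=
  let yts := [seq ctype (canon n p) | p <- abelian_types n] in
  let uts := [seq ctype (canon n (ld_type d)) | d <- data] in
  [&& uniq [seq ctype (canon n p) | p <- partitions n],
      all (fun p => cycles_ok n (blocks p)) (partitions n),
      all (fun p => [|| wodd n (canon n p), p \in map ld_type data |
                        covered_type n yts extra p]) (partitions n) &
      all (fun d => local_check n yts uts d (local_orbit n d) (local_pairs n d)) data].

Definition of_ctypes n (yts : seq (seq nat)) : {set {perm 'I_n}} :=
  [set y in 'Alt_('I_n) | ctype (word y) \in yts].

Lemma in_of_ctypes n yts (y : {perm 'I_n}) :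
  (y \in of_ctypes n yts) = (y \in 'Alt_('I_n)) && (ctype (word y) \in yts).
Proof. by rewrite in_set. Qed.

(** Both A_n and cycle types are invariant under conjugation in S_n. *)
Lemma uncovered_conj n yts (x t : {perm 'I_n}) :
  let V := uncovered 'Alt_('I_n) (of_ctypes n yts) in (x ^ t \in V) = (x \in V).
Proof.
have half (z u : {perm 'I_n}) : z \in uncovered 'Alt_('I_n) (of_ctypes n yts) ->
    z ^ u \in uncovered 'Alt_('I_n) (of_ctypes n yts).
  rewrite !in_uncovered Alt_conj => /andP[-> /forall_inP Vz] /=; apply/forall_inP=> y Yy.
  have Yyu : y ^ u^-1 \in of_ctypes n yts.
    by move: Yy; rewrite !in_of_ctypes ctype_conj Alt_conj.
  apply: contra (Vz _ Yyu) => /eqP czy; apply/eqP/(conjg_inj u).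
  by rewrite (conjMg z) (conjMg _ z) conjgKV.
by apply/idP/idP=> [/half-/(_ t^-1)|]; [rewrite conjgK | apply: half].
Qed.

(** The orbit K and its pairs are transported by the conjugation taking x to the
    canonical word. *)
Lemma local_resolution n yts uts d K ms (g : {perm 'I_n}) x :
    let V := uncovered 'Alt_('I_n) (of_ctypes n yts) in
    K = local_orbit n d ->
    local_check n yts uts d K ms ->
    (forall z, z \in V -> ctype (word z) \in uts) ->
    x \in V -> word (x ^ g) = canon n (ld_type d) ->
  exists C : {set {perm 'I_n}}, exists p : {perm 'I_n} -> {perm 'I_n},
    [/\ x \in C, {in C & V, forall a z : {perm 'I_n}, commute a z -> z \in C},
        {in C, forall a, p a \in V /\ commute a (p a)}
      & {in C &, forall a b, commute (p a) (p b) -> p a = p b /\ commute a b}].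
Proof.
move=> V defK /and5P[ok_d /allP wd_h K0 /allP clK].
case/and5P=> /allP centK /allP mK /allP xK /allP ncm /allP cliq utsV Vx def_x.
set s0 := x ^ g in def_x.
have Vs0 : s0 \in V by rewrite /V uncovered_conj.
have KP w : w \in K -> exists h : {perm 'I_n},
    w = word (s0 ^ h) /\ forall b : {perm 'I_n}, word b \in K -> word (b ^ h) \in K.
  rewrite {1}defK; move: w; apply: orbit_list_ind => [w k [h [-> Kh]] k_syms|w|w].
  - have [t def_k] := is_wordP (wd_h k k_syms); exists (h * t).
    split=> [|b Kb]; first by rewrite -def_k -word_conj conjgM.
    have:= allP (clK _ (Kh b Kb)) k k_syms.
    by rewrite -def_k -word_conj conjgM.
  - by rewrite inE => /eqP->; exists 1; rewrite conjg1 def_x; split=> // b; rewrite conjg1.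
  by rewrite inE => /eqP->; exists 1; rewrite conjg1 def_x; split=> // b; rewrite conjg1.
have KV (m : {perm 'I_n}) : word m \in K -> m \in V.
  by case/KP=> h [/word_inj-> _]; rewrite /V uncovered_conj.
have closedK (a z : {perm 'I_n}) : word a \in K -> z \in V -> commute a z -> word z \in K.
  case/KP=> h [/word_inj-> Kh] Vz caz; rewrite -(conjgKV h z); apply: Kh.
  have Vz' : z ^ h^-1 \in V by rewrite /V uncovered_conj.
  have cz' : commute s0 (z ^ h^-1).
    by apply: (conjg_inj h); rewrite (conjMg s0) (conjMg _ s0) conjgKV.
  have := centK _ (centralizer_words_complete ok_d def_x cz').
  rewrite odd_word; have := Vz'; rewrite in_uncovered Alt_even => /andP[/negPf-> _] /=.
  by case/andP=> _ /implyP/(_ (utsV _ Vz')).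
pose pair w := nth ([::], [::]) ms (find (meets^~ w) ms).
have pairP w : w \in K -> pair w \in ms /\ meets (pair w) w.
  by move=> /xK has_w; split; [rewrite mem_nth -?has_find | exact: (nth_find ([::], [::]) has_w)].
pose m w := of_word n (pair w).1.
have mP w : w \in K -> word (m w) = (pair w).1 /\ word (m w) \in K.
  move=> Kw; have [ms_w _] := pairP w Kw; have Km := mK _ ms_w.
  have -> : word (m w) = (pair w).1; last by [].
  by have [h [def_m _]] := KP _ Km; rewrite of_wordK // def_m is_word_word.
exists [set a | word (a ^ g) \in K], (fun a => m (word (a ^ g)) ^ g^-1).
split=> [|a z|a|a b].
- by rewrite inE def_x.
- rewrite in_set => Ka Vz caz; rewrite in_set.
  apply: (closedK (a ^ g)) => //; first by rewrite /V uncovered_conj.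
  by rewrite /commute -!conjMg caz.
- rewrite in_set => Ka; have [def_m Km] := mP _ Ka; rewrite /V uncovered_conj KV //; split=> //.
  have [_ /andP[cam _]] := pairP _ Ka; rewrite -def_m in cam.
  apply: (conjg_inj g); rewrite (conjMg a) (conjMg _ a) conjgKV.
  exact/wcommuteP.
rewrite !in_set => Ka Kb cpp.
have [def_ma _] := mP _ Ka; have [def_mb _] := mP _ Kb.
have [ms_a meet_a] := pairP _ Ka; have [ms_b meet_b] := pairP _ Kb.
have cmm : commute (m (word (a ^ g))) (m (word (b ^ g))).
  by apply: (conjg_inj g^-1); rewrite !conjMg.
have /eqP eq_pair : pair (word (a ^ g)) == pair (word (b ^ g)).
  have /allP/(_ _ ms_b)/implyP := ncm _ ms_a; apply.
  by rewrite -def_ma -def_mb; apply/wcommuteP.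
split; first by congr (_ ^ _); apply: word_inj; rewrite def_ma def_mb eq_pair.
have /allP cq := cliq _ ms_a; apply: (conjg_inj g); rewrite !conjMg; apply/wcommuteP.
have in_a : word (a ^ g) \in [seq w <- K | meets (pair (word (a ^ g))) w].
  by rewrite mem_filter meet_a.
by have /allP := cq _ in_a; apply; rewrite mem_filter Kb eq_pair meet_b.
Qed.

(** The set Y of [local_selectors] consists of the even permutations with a nearly
    distinct cycle type and an abelian centraliser in A_n; an element of V has one of
    the types in data. *)
Lemma delta_eq_Delta_of_selector_check n extra data :
  selector_check n extra data -> delta 'Alt_('I_n)%G = Delta 'Alt_('I_n)%G.
Proof.
rewrite /selector_check; set yts := [seq ctype (canon n p) | p <- abelian_types n].
set uts := [seq ctype (canon n (ld_type d)) | d <- data];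
case/and4P=> uniq_ct /allP ok_p /allP covP.
pose d0 := LocalData [::] [::] [::] [::]; move=> /(all_nthP d0) locP.
apply/delta_eq_Delta_selector; apply: (local_selectors (Y := of_ctypes n yts)).
- by apply/subsetP=> y; rewrite in_of_ctypes => /andP[].
- move=> y; rewrite in_of_ctypes => /andP[Gy /mapP[p]].
  rewrite !mem_filter => /andP[/andP[_ ab_p] /andP[_ pn]] ct_y.
  have ok := ok_p p pn; have def_s := word_of_cycles ok.
  have eq_ct : ctype (word (of_cycles n (blocks p))) = ctype (word y) by rewrite def_s ct_y.
  have [t ->] := ctype_class uniq_ct eq_ct.
  exact: abelian_cent_Alt_conj (abelian_cent_Alt_words ok def_s ab_p).
set V := uncovered _ _.
have typeV x : x \in V -> exists2 i, i < size data &
    exists g, word (x ^ g) = canon n (ld_type (nth d0 data i)).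
  move=> Vx; have [p pn [g def_x]] := canonical_conj x.
  have Vxg : x ^ g \in V by rewrite /V uncovered_conj.
  have := covP p pn; rewrite /canon -def_x odd_word; case/or3P.
  - by move=> odd_x; have:= Vxg; rewrite in_uncovered Alt_even odd_x.
  - case/(nthP [::])=> i; rewrite size_map => lt_i def_p; exists i => //; exists g.
    by rewrite def_x -def_p (nth_map d0).
  case/hasP=> ys _ /and4P[/is_wordP[y <-]]; rewrite /canon -def_x.
  move=> /wcommuteP cxy even_y ct_y; have:= Vxg.
  rewrite in_uncovered => /andP[_ /forall_inP/(_ y)].
  rewrite in_of_ctypes Alt_even -odd_word even_y ct_y => /(_ isT)/eqP[].
  exact: cxy.
have utsV z : z \in V -> ctype (word z) \in uts.
  case/typeV=> i lt_i [g def_z]; rewrite -(ctype_conj z g) def_z.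
  by apply/(nthP [::]); exists i; rewrite ?size_map // (nth_map d0) //.
move=> x Vx; have [i lt_i [g def_x]] := typeV x Vx.
exact: local_resolution (erefl _) (locP i lt_i) utsV Vx def_x.
Qed.

(** The elements of type (4, 4) with a given square t form two copies of the set of
    elements of order 4 of a quaternion group, acting by left and by right
    multiplications.  Each left one commutes with each right one, and two elements on
    the same side commute only if they are equal or inverse: the commuting graph is
    K_{3,3}, up to inversion.  The selected elements are those of one side, each
    matched with an element of the other; the shift (1 4 5)(3 6 7) permutes i, j
    and k. *)
Definition data8 := [:: LocalData [:: 4; 4]
  [:: [:: [:: 1; 4; 5]; [:: 3; 6; 7]]; [:: [:: 5; 7]]]
  [:: ([:: [:: 0; 1; 2; 3]; [:: 4; 7; 6; 5]], [:: [:: 0; 4; 2; 6]; [:: 1; 7; 3; 5]])]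
  [:: [:: [:: 1; 4; 5]; [:: 3; 6; 7]]]]%N.

Definition data9 := [:: LocalData [:: 4; 4; 1]
  [:: [:: [:: 1; 4; 5]; [:: 3; 6; 7]]; [:: [:: 5; 7]]]
  [:: ([:: [:: 0; 1; 2; 3]; [:: 4; 7; 6; 5]], [:: [:: 0; 4; 2; 6]; [:: 1; 7; 3; 5]])]
  [:: [:: [:: 1; 4; 5]; [:: 3; 6; 7]]]]%N.

Definition data11 := [:: LocalData [:: 4; 4; 3]
  [:: [:: [:: 1; 4; 5]; [:: 3; 6; 7]]; [:: [:: 5; 7]]; [:: [:: 9; 10]]]
  [:: ([:: [:: 0; 1; 2; 3]; [:: 4; 7; 6; 5]; [:: 8; 9; 10]],
       [:: [:: 0; 4; 2; 6]; [:: 1; 7; 3; 5]; [:: 8; 9; 10]])]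
  [:: [:: [:: 1; 4; 5]; [:: 3; 6; 7]]]]%N.

(** Elements of type (6, 4, 3, 1, 1), for the types (6, 3, 2, 2, 2),
    (6, 3, 2, 1, 1, 1, 1), (6, 2, 2, 2, 1, 1, 1) and (4, 3, 3, 2, 1, 1, 1)
    in this order.  Here y fixes the two points of a 2-cycle of x, so x is not a
    product of powers of the cycles of y. *)
Definition extra15 : seq (seq (seq nat)) :=
  [:: [:: iota 0 6; [:: 6; 7; 8]; [:: 11; 13; 12; 14]];
      [:: iota 0 6; [:: 6; 7; 8]; [:: 11; 12; 13; 14]];
      [:: iota 0 6; [:: 8; 10; 9; 11]; [:: 12; 13; 14]];
      [:: [:: 0; 1; 2; 3]; [:: 4; 7; 5; 8; 6; 9]; [:: 12; 13; 14]]]%N.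

(** Type (7, 4, 4) is the case of (4, 4) again.

    Type (6, 4, 2, 2, 1): split the eight points of the cycles 4, 2, 2 into halves A, B
    of four points.  Up to inverses a vertex is P(i,j) or Q(i,j), with i, j = 1, 2, 3:
    a 4-cycle whose square is the i-th double transposition of A together with
    the j-th double transposition of B, or the reverse.  The cliques are the three
    rows of P and the three columns of Q; P(i,j) and Q(i,j) commute.  With
    the double transpositions numbered along the shift, one selects P(i,i) and
    Q(i,i-1), indices modulo 3.

    Type (6, 3, 3, 2, 1): on two halves of six points a vertex is a 6-cycle s on one
    half and a product g of two 3-cycles on the other.  The cliques join g = c c' to
    c c'^-1.  The vertices (s, g) and (s^2, h) with h^2 = g commute.  On each
    half give opposite signs to c c' and c c'^-1: one selects (s, g) when s^2 and g have
    opposite signs if s moves the first half, and equal signs if s moves the second.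

    Type (6, 6, 3): the square of the two 6-cycles consists of four 3-cycles, and
    four orientations of these occur, up to a global sign.  For each of them
    the vertices are the 27 lines parallel to the axes in the cube F_3^3, two lines
    commuting when they meet: each point of the cube is a clique of three lines.
    Nine points forming a Latin square meet all lines; one direction of lines is
    selected for each orientation.  The two shifts are translations along a basis
    of the ternary tetracode of length four. *)
Definition data15 :=
  [:: LocalData [:: 7; 4; 4]
        [:: [:: [:: 8; 11; 12]; [:: 10; 13; 14]]; [:: [:: 12; 14]]; [:: [:: 1; 3; 2; 6; 4; 5]]]
        [:: ([:: iota 0 7; [:: 7; 8; 9; 10]; [:: 11; 14; 13; 12]],
             [:: iota 0 7; [:: 7; 11; 9; 13]; [:: 8; 14; 10; 12]])]
        [:: [:: [:: 8; 11; 12]; [:: 10; 13; 14]]];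
      LocalData [:: 6; 4; 2; 2; 1]
        [:: [:: [:: 7; 8; 9]]; [:: [:: 6; 10]; [:: 7; 11]; [:: 8; 12]; [:: 9; 13]];
            [:: [:: 1; 5]; [:: 2; 4]]; [:: [:: 7; 9]]]
        [:: ([:: iota 0 6; [:: 6; 7; 8; 9]; [:: 10; 12]; [:: 11; 13]],
             [:: iota 0 6; [:: 6; 7; 8; 9]; [:: 10; 11]; [:: 12; 13]]);
            ([:: iota 0 6; [:: 6; 7]; [:: 8; 9]; [:: 10; 11; 13; 12]],
             [:: iota 0 6; [:: 6; 8]; [:: 7; 9]; [:: 10; 11; 13; 12]])]
        [:: [:: [:: 7; 8; 9]; [:: 11; 12; 13]]];
      LocalData [:: 6; 3; 3; 2; 1]
        [:: [:: [:: 0; 2; 4]];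
            [:: [:: 0; 6]; [:: 2; 7]; [:: 4; 8]; [:: 1; 9]; [:: 3; 10]; [:: 5; 11]];
            [:: [:: 7; 8]]; [:: [:: 7; 8]; [:: 10; 11]]]
        [:: ([:: iota 0 6; [:: 6; 7; 8]; [:: 9; 11; 10]; [:: 12; 13]],
             [:: iota 0 6; [:: 6; 7; 8]; [:: 9; 10; 11]; [:: 12; 13]]);
            ([:: [:: 0; 1; 2; 5; 4; 3]; [:: 6; 7; 8]; [:: 9; 10; 11]; [:: 12; 13]],
             [:: [:: 0; 1; 2; 5; 4; 3]; [:: 6; 7; 8]; [:: 9; 11; 10]; [:: 12; 13]]);
            ([:: [:: 0; 2; 4]; [:: 1; 3; 5]; [:: 6; 9; 7; 10; 8; 11]; [:: 12; 13]],
             [:: [:: 0; 2; 4]; [:: 1; 5; 3]; [:: 6; 9; 7; 10; 8; 11]; [:: 12; 13]]);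
            ([:: [:: 0; 2; 4]; [:: 1; 5; 3]; [:: 6; 9; 7; 11; 8; 10]; [:: 12; 13]],
             [:: [:: 0; 2; 4]; [:: 1; 3; 5]; [:: 6; 9; 7; 11; 8; 10]; [:: 12; 13]])]
        [:: [:: [:: 0; 2; 4]]; [:: [:: 6; 7; 8]]];
      LocalData [:: 6; 6; 3]
        [:: [:: [:: 0; 2; 4]]; [:: [:: 0; 1; 6]; [:: 2; 3; 8]; [:: 4; 5; 10]];
            [:: [:: 9; 11]; [:: 8; 10]]; [:: [:: 13; 14]]]
        [:: ([:: [:: 0; 6; 2; 8; 4; 10]; [:: 1; 7; 3; 9; 5; 11]; [:: 12; 13; 14]],
             [:: [:: 0; 3; 4; 1; 2; 5]; [:: 6; 9; 10; 7; 8; 11]; [:: 12; 13; 14]]);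
            ([:: [:: 0; 7; 4; 9; 2; 11]; [:: 1; 6; 3; 10; 5; 8]; [:: 12; 13; 14]],
             [:: [:: 0; 1; 2; 5; 4; 3]; [:: 6; 11; 8; 9; 10; 7]; [:: 12; 13; 14]]);
            ([:: [:: 0; 6; 2; 10; 4; 8]; [:: 1; 7; 3; 11; 5; 9]; [:: 12; 13; 14]],
             [:: [:: 0; 1; 2; 3; 4; 5]; [:: 6; 7; 10; 11; 8; 9]; [:: 12; 13; 14]]);
            ([:: [:: 0; 1; 2; 5; 4; 3]; [:: 6; 7; 10; 9; 8; 11]; [:: 12; 13; 14]],
             [:: [:: 0; 6; 2; 10; 4; 8]; [:: 1; 7; 5; 9; 3; 11]; [:: 12; 13; 14]])]
        [:: [:: [:: 1; 3; 5]; [:: 6; 8; 10]; [:: 7; 9; 11]];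
            [:: [:: 0; 2; 4]; [:: 6; 8; 10]; [:: 7; 11; 9]]]]%N.

Lemma selector_check_no_data :
  all (fun n => selector_check n [::] [::]) [:: 1; 2; 3; 4; 5; 6; 7; 10]%N.
Proof. by vm_compute. Qed.

Lemma selector_check8 : selector_check 8 [::] data8.
Proof. by vm_compute. Qed.

Lemma selector_check9 : selector_check 9 [::] data9.
Proof. by vm_compute. Qed.

Lemma selector_check11 : selector_check 11 [::] data11.
Proof. by vm_compute. Qed.

Lemma selector_check15 : selector_check 15 extra15 data15.
Proof. by vm_compute. Qed.

Lemma delta_eq_Delta_Alt n :
  0 < n -> n <= 11 \/ n = 15 -> delta 'Alt_('I_n)%G = Delta 'Alt_('I_n)%G.
Proof.
move=> n_gt0 [n_le11|->]; last exact: (delta_eq_Delta_of_selector_check selector_check15).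
have [n8|n_neq8] := eqVneq n 8.
  by rewrite n8; exact: (delta_eq_Delta_of_selector_check selector_check8).
have [n9|n_neq9] := eqVneq n 9.
  by rewrite n9; exact: (delta_eq_Delta_of_selector_check selector_check9).
have [n11|n_neq11] := eqVneq n 11.
  by rewrite n11; exact: (delta_eq_Delta_of_selector_check selector_check11).
apply: (@delta_eq_Delta_of_selector_check n [::] [::]).
apply: (allP selector_check_no_data); move: n n_gt0 n_le11 n_neq8 n_neq9 n_neq11.
by do 12?case=> //.
Qed.

Theorem theorem1p2 (n : nat) (n_gt0 : 0 < n) :
  (n <= 11 \/ n = 15 ->
     delta 'Alt_('I_n)%G = Delta 'Alt_('I_n)%G) /\
  (n = 12 \/ n = 16 \/ n = 18 \/ 20 <= n ->
     delta 'Alt_('I_n)%G <> Delta 'Alt_('I_n)%G).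
Proof.
split; first exact: delta_eq_Delta_Alt.
exact: delta_neq_Delta_Alt.
Qed.
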